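(* Let $f:[0,+\infty)\to(-\infty,0]$ be a smooth function with $f(0)=0$ and $f'(t)<0$ for all $t\ge0$. The $S^1$-action and the $\mathbb{P}\mathrm{SL}(2,\mathbb{R})$-action on $\mathcal{MF}(T^2)$ are Hamiltonian with respect to $\boldsymbol{\omega}_f$. Moreover, their Hamiltonians can be chosen as action variables in a global Darboux frame for $\boldsymbol{\omega}_f$: there is a global Darboux frame $\{\theta_1,H_1,\theta_2,H_2\}$ on $\mathcal{MF}(T^2)$, with $\boldsymbol{\omega}_f=d\theta_1\wedge dH_1+d\theta_2\wedge dH_2$ and $\theta_1,\theta_2$ angle coordinates, in which $H_1$ is a Hamiltonian of the $S^1$-action and $H_2$ is a Hamiltonian of the $\mathbb{P}\mathrm{SL}(2,\mathbb{R})$-action (a component $\mu^\xi$, $0\neq\xi\in\mathfrak{sl}(2,\mathbb{R})$, of its moment map $\mu$).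
   Context: Linear model. Let $\rho_0=dx_0\wedge dy_0$ on $\mathbb{R}^2$, and $\mathcal{J}(\mathbb{R}^2)=\{J\in\mathrm{End}(\mathbb{R}^2): J^2=-\mathrm{Id},\ \rho_0(v,Jv)>0 \text{ for some } v\ne 0\}$, with $T_J\mathcal{J}(\mathbb{R}^2)=\{\dot J: J\dot J+\dot JJ=0\}$. For $J\in\mathcal{J}(\mathbb{R}^2)$, $g_J(\cdot,\cdot)=\rho_0(\cdot,J\cdot)$. Let $\mathcal{M}(\mathbb{R}^2)=\{(J,T): J\in\mathcal{J}(\mathbb{R}^2),\ T \text{ a totally symmetric } (0,4)\text{-tensor on } \mathbb{R}^2,\ T(J\cdot,J\cdot,\cdot,\cdot)=-T\}$, a smooth $4$-manifold. To $(J,T)$ associate $U=g_J^{-1}T$, i.e. $U(X,Y)\in\mathrm{End}(\mathbb{R}^2)$ with $g_J(U(X,Y)Z,W)=T(X,Y,Z,W)$; write $(J,U)$ for $(J,T)$. Identification. $\mathcal{T}(T^2)\cong\mathcal{J}(\mathbb{R}^2)$, and the bundle $\mathcal{Q}^4(T^2)$ of holomorphic quartic differentials over $\mathcal{T}(T^2)$ is identified with $\mathcal{M}(\mathbb{R}^2)$ by $T=\mathrm{Re}(q)$, $q=T-iT(\cdot,\cdot,\cdot,J\cdot)$. $\mathcal{MF}(T^2)$, the space of complete flat maximal space-like embeddings $\mathbb{R}^2\hookrightarrow\mathbb{H}^{2,2}$ equivariant under a faithful representation $\pi_1(T^2)\to\mathrm{SO}_0(2,3)$, up to $\mathrm{SO}_0(2,3)$,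 is identified with the complement of the zero section in $\mathcal{Q}^4(T^2)\cong\mathcal{M}(\mathbb{R}^2)$. Actions. $S^1$ acts by rotation along the fibres, $\theta\cdot(J,q)=(J,e^{-i\theta}q)$. $\mathbb{P}\mathrm{SL}(2,\mathbb{R})$ acts by pull-back, $A\cdot(J,q)=(AJA^{-1},(A^{-1})^*q)$ (the element $-\mathrm{Id}$ of $\mathrm{SL}(2,\mathbb{R})$ acts trivially). Tensors. A tangent vector at $(J,U)$ is written $(\dot J,\dot U)$, where $\dot J,\dot T$ are the first variations of $J,T$ along a curve and $\dot U:=g_J^{-1}\dot T$. Put $\dot U_{\mathrm{tr}}(X,Y)=\tfrac12\mathrm{tr}(\dot U(X,Y))\mathrm{Id}$ and $\dot U_0=\dot U-\dot U_{\mathrm{tr}}$. Let $\langle\dot J,\dot J'\rangle=\tfrac12\mathrm{tr}(\dot J\dot J')$ and, for symmetric bilinear forms $V,V'$ with values in $\mathrm{End}(\mathbb{R}^2)$, $\langle V,V'\rangle=\tfrac14\sum_{i,j=1}^2\mathrm{tr}\big(V(e_i,e_j)V'(e_i,e_j)\big)$ with $\{e_1,e_2=Je_1\}$ $g_J$-orthonormal; $\|U\|^2=\langle U,U\rangle$. Define $$\mathbf{g}_f\big((\dot J,\dot U),(\dot J',\dot U')\big)=\Big(1-f\big(\tfrac{\|U\|^2}{2}\big)\Big)\langle\dot J,\dot J'\rangle+\tfrac12f'\big(\tfrac{\|U\|^2}{2}\big)\Big(\langle\dot U_0,\dot U_0'\rangle-\langle\dot U_{\mathrm{tr}},\dot U_{\mathrm{tr}}'\rangle\Big),$$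 $\mathbf{I}(\dot J,\dot U)=(-J\dot J,-\dot UJ-U\dot J)$ (products being compositions of endomorphisms), and $\boldsymbol{\omega}_f(\cdot,\cdot)=\mathbf{g}_f(\cdot,\mathbf{I}\cdot)$, a symplectic form on $\mathcal{MF}(T^2)$. Hamiltonian actions. An action of a Lie group $G$ on a symplectic manifold $(M,\omega)$ by symplectomorphisms is Hamiltonian if there is a smooth moment map $\mu:M\to\mathfrak{g}^*$ with $\mu_{g\cdot p}=\mu_p\circ\mathrm{Ad}(g^{-1})$ and $d\mu^\xi=\omega(X_\xi,\cdot)$ for all $\xi\in\mathfrak{g}$, where $\mu^\xi(p)=\mu_p(\xi)$ and $X_\xi=\frac{d}{dt}\exp(t\xi)\cdot p|_{t=0}$. Here ''angle coordinates'' are as in the Arnold–Liouville theorem: coordinates along the fibres of $(H_1,H_2)$, whose fibres are diffeomorphic to $S^1\times\mathbb{R}$, with $\theta_1$ taking values in $\mathbb{R}/2\pi\mathbb{Z}$ and $\theta_2$ in $\mathbb{R}$. *)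

(* Defs.v *)
From HB Require Import structures.
From mathcomp Require Import all_boot all_order all_algebra.
From mathcomp Require Import complex ring lra.
From mathcomp Require Import all_classical all_reals all_analysis.

Set Implicit Arguments.
Unset Strict Implicit.
Unset Printing Implicit Defensive.

Import Order.TTheory GRing.Theory Num.Theory.
Import numFieldNormedType.Exports.

Local Open Scope classical_set_scope.
Local Open Scope ring_scope.
Local Open Scope quotient_scope.

(* Functions on the closed half-line [0, +oo[: [f] is total, but only its
   values on [0, +oo[ are ever used, and the derivative at 0 is one-sided. *)

Definition half_line_quot (R : realType) (f : R -> R) (t : R) :=
  h^-1 * (f (t + h) - f t) @[h --> within [set h | 0 <= t + h] (0 : R)^'].

Definition half_line_derive (R : realType) (f : R -> R) (t : R) : R :=
  lim (half_line_quot f t).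

Definition smooth_half_line (R : realType) (f : R -> R) : Prop :=
  forall (k : nat) (t : R), 0 <= t ->
    cvg (half_line_quot (iter k (@half_line_derive R) f) t).

(* Embedded submanifolds of a finite-dimensional normed space [V] are given by
   their underlying sets. A smooth map on [M] is represented by a total
   function on [V] that is smooth on some open neighbourhood of [M]; on vectors
   tangent to [M] its derivative depends only on its restriction to [M]. *)

(* [Ck k]: all iterated directional derivatives up to order [k] exist and are
   continuous. *)
Fixpoint Ck (R : realType) (V W : normedModType R) (k : nat) (O : set V)
    (F : V -> W) : Prop :=
  if k is k'.+1 then
    (forall x, O x -> differentiable F x) /\ (forall v : V, Ck k' O ('D_v F))
  else forall x, O x -> {for x, continuous F}.

Definition smooth (R : realType) (V W : normedModType R) (O : set V)
    (F : V -> W) : Prop := forall k, Ck k O F.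

Definition smooth_on (R : realType) (V W : normedModType R) (M : set V)
    (F : V -> W) : Prop := exists O : set V, [/\ open O, M `<=` O & smooth O F].

Definition diffeomorphism (R : realType) (V W : normedModType R) (M : set V)
    (N : set W) (F : V -> W) : Prop :=
  [/\ smooth_on M F, (forall p, M p -> N (F p)) &
      exists G : W -> V, [/\ smooth_on N G, (forall x, N x -> M (G x)),
        (forall p, M p -> G (F p) = p) & (forall x, N x -> F (G x) = x)]].

Definition tangent (R : realType) (V : normedModType R) (M : set V) (p v : V) :
    Prop :=
  exists (O : set R) (c : R -> V),
    [/\ open O, O 0, smooth O c, (forall t, O t -> M (c t)) &
        c 0 = p /\ derive1 c 0 = v].

(* The data of a Lie group that enter the notion of a moment map. *)

Record lieGroup (R : realType) := LieGroup {
  lie_group :> groupType;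
  lie_algebra : lmodType R;
  lie_exp : lie_algebra -> lie_group;
  lie_Ad : lie_group -> lie_algebra -> lie_algebra }.

Section Hamiltonian.
Variables (R : realType) (V : normedModType R) (M : set V).
Variables (omega : V -> V -> V -> R) (G : lieGroup R) (act : G -> V -> V).

Definition symplectic_action : Prop :=
  [/\ (forall g, smooth_on M (act g) /\ (forall p, M p -> M (act g p))),
      (forall p, M p -> act 1%g p = p),
      (forall g h p, M p -> act (g * h)%g p = act g (act h p)) &
      (forall g p v w, M p -> tangent M p v -> tangent M p w ->
         omega (act g p) ('D_v (act g) p) ('D_w (act g) p) = omega p v w)].

Definition action_orbit (xi : lie_algebra G) (p : V) : R -> V :=
  fun t => act (lie_exp (t *: xi)) p.

Definition fundamental_field (xi : lie_algebra G) (p : V) : V :=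
  derive1 (action_orbit xi p) 0.

(* As the Lie algebra is finite-dimensional, smoothness of [mu] as a map to its
   dual amounts to smoothness of all [mu ^~ xi]. *)
Definition moment_map (mu : V -> {scalar (lie_algebra G)}) : Prop :=
  [/\ (forall xi, smooth_on M (fun p => mu p xi : R)),
      (forall g p xi, M p -> mu (act g p) xi = mu p (lie_Ad g^-1%g xi)) &
      (forall xi p, M p -> derivable (action_orbit xi p) 0 1 /\
         forall v, tangent M p v ->
           'D_v (fun p' => mu p' xi : R) p = omega p (fundamental_field xi p) v)].

Definition hamiltonian_action : Prop :=
  symplectic_action /\ exists mu, moment_map mu.

End Hamiltonian.

(* The circle group, R/2piZ being identified with it by t |-> e^(it). *)

Section Circle.
Variable R : realType.

Record circle := Circle { circle_val :> R[i]; _ : `|circle_val| == 1 }.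
HB.instance Definition _ := [isSub for circle_val].
HB.instance Definition _ := [Choice of circle by <:].

Lemma circle_neq0 (z : circle) : val z != 0.
Proof. by rewrite -normr_gt0 (eqP (valP z)) ltr01. Qed.

Lemma circle1_subproof : `|1 : R[i]| == 1.
Proof. by rewrite normr1. Qed.
Lemma circleM_subproof (z w : circle) : `|val z * val w| == 1.
Proof. by rewrite normrM (eqP (valP z)) (eqP (valP w)) mulr1. Qed.
Lemma circleV_subproof (z : circle) : `|(val z)^-1| == 1.
Proof. by rewrite normfV (eqP (valP z)) invr1. Qed.
Lemma circle_exp_subproof (t : R) : `|(cos t +i* sin t)%C : R[i]| == 1.
Proof. by rewrite normc_def /= cos2Dsin2 sqrtr1. Qed.

Definition circle1 : circle := Circle circle1_subproof.
Definition circleM (z w : circle) : circle := Circle (circleM_subproof z w).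
Definition circleV (z : circle) : circle := Circle (circleV_subproof z).

Lemma circleMA : associative circleM.
Proof. by move=> x y z; apply: val_inj; rewrite /= mulrA. Qed.
Lemma circle1M : left_id circle1 circleM.
Proof. by move=> x; apply: val_inj; rewrite /= mul1r. Qed.
Lemma circleM1 : right_id circle1 circleM.
Proof. by move=> x; apply: val_inj; rewrite /= mulr1. Qed.
Lemma circleVM : left_inverse circle1 circleV circleM.
Proof. by move=> x; apply: val_inj; rewrite /= mulVf ?circle_neq0. Qed.
Lemma circleMV : right_inverse circle1 circleV circleM.
Proof. by move=> x; apply: val_inj; rewrite /= mulfV ?circle_neq0. Qed.

HB.instance Definition _ :=
  isGroup.Build circle circleMA circle1M circleM1 circleVM circleMV.

Definition circle_exp (t : R^o) : circle := Circle (circle_exp_subproof t).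

Definition S1 : lieGroup R :=
  {| lie_group := circle; lie_algebra := R^o;
     lie_exp := circle_exp; lie_Ad := fun _ xi => xi |}.

Definition angle_re (V : Type) (th : V -> circle) (p : V) : R :=
  complex.Re (val (th p)).
Definition angle_im (V : Type) (th : V -> circle) (p : V) : R :=
  complex.Im (val (th p)).

(* [d theta] for an angle valued in R/2piZ: with e^(i theta) = c + i s,
   [d theta = c ds - s dc]. *)
Definition dangle (V : normedModType R) (th : V -> circle) (p v : V) : R :=
  angle_re th p * 'D_v (angle_im th) p - angle_im th p * 'D_v (angle_re th) p.

End Circle.

(* [th1, th2, H1, H2] are global coordinates, identifying [M] with
   S^1 x R x B, so that each fibre of [(H1, H2)] is identified with S^1 x R by
   [(th1, th2)]. *)
Definition darboux_frame (R : realType) (V : normedModType R) (M : set V)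
    (omega : V -> V -> V -> R)
    (th1 : V -> circle R) (H1 th2 H2 : V -> R) : Prop :=
  (exists B : set (R * R), open B /\
     diffeomorphism M
       [set x : (R * R) * R * (R * R) |
          x.1.1.1 ^+ 2 + x.1.1.2 ^+ 2 = 1 /\ B x.2]
       (fun p => (angle_re th1 p, angle_im th1 p, th2 p, (H1 p, H2 p))))
  /\ (forall p v w, M p -> tangent M p v -> tangent M p w ->
        omega p v w =
          (dangle th1 p v * 'D_w H1 p - dangle th1 p w * 'D_v H1 p)
        + ('D_v th2 p * 'D_w H2 p - 'D_w th2 p * 'D_v H2 p)).

Section PSL2.
Variable R : realType.

Record SL2 := MkSL2 { SL2_val :> 'M[R]_2; _ : \det SL2_val == 1 }.
HB.instance Definition _ := [isSub for SL2_val].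
HB.instance Definition _ := [Choice of SL2 by <:].

Lemma SL2_unit (A : SL2) : val A \in unitmx.
Proof. by rewrite unitmxE (eqP (valP A)) unitr1. Qed.

Lemma SL2_1_subproof : \det (1%:M : 'M[R]_2) == 1.
Proof. by rewrite det1. Qed.
Lemma SL2_M_subproof (A B : SL2) : \det (val A *m val B) == 1.
Proof. by rewrite det_mulmx (eqP (valP A)) (eqP (valP B)) mulr1. Qed.
Lemma SL2_V_subproof (A : SL2) : \det (invmx (val A)) == 1.
Proof. by rewrite det_inv (eqP (valP A)) invr1. Qed.

Definition SL2_1 : SL2 := MkSL2 SL2_1_subproof.
Definition SL2_M (A B : SL2) : SL2 := MkSL2 (SL2_M_subproof A B).
Definition SL2_V (A : SL2) : SL2 := MkSL2 (SL2_V_subproof A).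

Definition eq_up_to_sign : rel SL2 :=
  fun A B => (val A == val B) || (val A == - val B).

Lemma eq_up_to_sign_refl : reflexive eq_up_to_sign.
Proof. by move=> A; rewrite /eq_up_to_sign eqxx. Qed.
Lemma eq_up_to_sign_sym : symmetric eq_up_to_sign.
Proof.
by move=> A B; rewrite /eq_up_to_sign eq_sym [val B == - _]eq_sym eqr_oppLR.
Qed.
Lemma eq_up_to_sign_trans : transitive eq_up_to_sign.
Proof.
move=> B A C; rewrite /eq_up_to_sign.
by move=> /orP[] /eqP-> /orP[] /eqP->; rewrite ?opprK ?eqxx ?orbT.
Qed.

Canonical eq_up_to_sign_equiv :=
  EquivRel eq_up_to_sign eq_up_to_sign_refl eq_up_to_sign_sym
    eq_up_to_sign_trans.

Definition PSL2 := {eq_quot eq_up_to_sign}.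
HB.instance Definition _ := Choice.on PSL2.
HB.instance Definition _ := EqQuotient.on PSL2.

Definition PSL2_1 : PSL2 := \pi_PSL2 SL2_1.
Definition PSL2_M (g h : PSL2) : PSL2 := \pi_PSL2 (SL2_M (repr g) (repr h)).
Definition PSL2_V (g : PSL2) : PSL2 := \pi_PSL2 (SL2_V (repr g)).

Lemma PSL2_repr_pi (A : SL2) :
  SL2_val (repr (\pi_PSL2 A)) = SL2_val A \/
  SL2_val (repr (\pi_PSL2 A)) = - SL2_val A.
Proof.
have : \pi_PSL2 (repr (\pi_PSL2 A)) == \pi_PSL2 A by rewrite reprK.
by rewrite eqmodE => /orP[] /eqP; [left|right].
Qed.

Lemma PSL2_eqP (g h : PSL2) : SL2_val (repr g) = SL2_val (repr h) \/
  SL2_val (repr g) = - SL2_val (repr h) -> g = h.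
Proof.
move=> H; rewrite -[g]reprK -[h]reprK; apply/eqP; rewrite eqmodE.
by case: H => /= H; apply/orP; [left|right]; apply/eqP.
Qed.

Lemma PSL2_MA : associative PSL2_M.
Proof.
move=> g h k; apply: PSL2_eqP; rewrite /PSL2_M.
case: (PSL2_repr_pi (SL2_M (repr g) (repr (\pi_PSL2 (SL2_M (repr h) (repr k))))))
  => ->;
case: (PSL2_repr_pi (SL2_M (repr (\pi_PSL2 (SL2_M (repr g) (repr h)))) (repr k)))
  => -> /=;
case: (PSL2_repr_pi (SL2_M (repr h) (repr k))) => -> /=;
case: (PSL2_repr_pi (SL2_M (repr g) (repr h))) => -> /=;
  rewrite ?(mulmxN, mulNmx, opprK) mulmxA; by [left|right].
Qed.
Lemma PSL2_1M : left_id PSL2_1 PSL2_M.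
Proof.
move=> g; apply: PSL2_eqP; rewrite /PSL2_M /PSL2_1.
case: (PSL2_repr_pi (SL2_M (repr (\pi_PSL2 SL2_1)) (repr g))) => -> /=;
case: (PSL2_repr_pi SL2_1) => -> /=;
  rewrite ?(mulmxN, mulNmx, opprK) mul1mx; by [left|right].
Qed.
Lemma PSL2_M1 : right_id PSL2_1 PSL2_M.
Proof.
move=> g; apply: PSL2_eqP; rewrite /PSL2_M /PSL2_1.
case: (PSL2_repr_pi (SL2_M (repr g) (repr (\pi_PSL2 SL2_1)))) => -> /=;
case: (PSL2_repr_pi SL2_1) => -> /=;
  rewrite ?(mulmxN, mulNmx, opprK) mulmx1; by [left|right].
Qed.
Lemma PSL2_VM : left_inverse PSL2_1 PSL2_V PSL2_M.
Proof.
move=> g; apply: PSL2_eqP; rewrite /PSL2_M /PSL2_1 /PSL2_V.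
case: (PSL2_repr_pi (SL2_M (repr (\pi_PSL2 (SL2_V (repr g)))) (repr g)))
  => -> /=;
case: (PSL2_repr_pi SL2_1) => -> /=;
case: (PSL2_repr_pi (SL2_V (repr g))) => -> /=;
  rewrite ?(mulmxN, mulNmx, opprK) mulVmx ?SL2_unit //; by [left|right].
Qed.
Lemma PSL2_MV : right_inverse PSL2_1 PSL2_V PSL2_M.
Proof.
move=> g; apply: PSL2_eqP; rewrite /PSL2_M /PSL2_1 /PSL2_V.
case: (PSL2_repr_pi (SL2_M (repr g) (repr (\pi_PSL2 (SL2_V (repr g))))))
  => -> /=;
case: (PSL2_repr_pi SL2_1) => -> /=;
case: (PSL2_repr_pi (SL2_V (repr g))) => -> /=;
  rewrite ?(mulmxN, mulNmx, opprK) mulmxV ?SL2_unit //; by [left|right].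
Qed.

HB.instance Definition _ :=
  isGroup.Build PSL2 PSL2_MA PSL2_1M PSL2_M1 PSL2_VM PSL2_MV.

Definition traceless : {pred 'M[R]_2} := fun A => \tr A == 0.

Lemma traceless_submod : submod_closed traceless.
Proof.
split; first by rewrite /in_mem /= /traceless mxtrace0.
move=> a A B; rewrite /in_mem /= /traceless => /eqP tA /eqP tB.
by rewrite mxtraceD mxtraceZ tA tB mulr0 addr0.
Qed.
HB.instance Definition _ :=
  GRing.isSubmodClosed.Build R 'M[R]_2 traceless traceless_submod.

Record sl2 := MkSl2 { sl2_val :> 'M[R]_2; _ : sl2_val \in traceless }.
HB.instance Definition _ := [isSub for sl2_val].
HB.instance Definition _ := [Choice of sl2 by <:].
HB.instance Definition _ := [SubChoice_isSubLmodule of sl2 by <:].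

Definition expmx (A : 'M[R]_2) : 'M[R]_2 :=
  limn (series (fun k => (k`!%:R)^-1 *: A ^+ k)).

(* [\det (expmx xi) = 1] for traceless [xi], so the default value of [insubd]
   is never taken. *)
Definition PSL2_exp (xi : sl2) : PSL2 := \pi_PSL2 (insubd SL2_1 (expmx xi)).

Lemma PSL2_Ad_subproof (g : PSL2) (xi : sl2) :
  SL2_val (repr g) *m xi *m invmx (SL2_val (repr g)) \in traceless.
Proof.
rewrite /in_mem /= /traceless mxtrace_mulC mulmxA mulVmx ?SL2_unit // mul1mx.
exact: (valP xi).
Qed.
Definition PSL2_Ad (g : PSL2) (xi : sl2) : sl2 := MkSl2 (PSL2_Ad_subproof g xi).

Definition PSL2R : lieGroup R :=
  {| lie_group := PSL2; lie_algebra := sl2;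
     lie_exp := PSL2_exp; lie_Ad := PSL2_Ad |}.

End PSL2.

Section Tensors.
Variable R : realType.
Implicit Types (J A : 'M[R]_2) (T : 'M[R]_(2 * 2)) (X Y Z W : 'cV[R]_2).

Definition ebasis (i : 'I_2) : 'cV[R]_2 := delta_mx i 0.

Definition rho0 X Y : R := X 0 0 * Y 1 0 - X 1 0 * Y 0 0.

(* A (0,4)-tensor is stored through its components on the standard basis,
   T(e_i, e_j, e_k, e_l) being the entry of index ((i, j), (k, l)). *)
Definition teval T X Y Z W : R :=
  \sum_(i < 2) \sum_(j < 2) \sum_(k < 2) \sum_(l < 2)
    T (mxvec_index i j) (mxvec_index k l) * X i 0 * Y j 0 * Z k 0 * W l 0.

Definition tensor (t : 'cV[R]_2 -> 'cV[R]_2 -> 'cV[R]_2 -> 'cV[R]_2 -> R) :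
    'M[R]_(2 * 2) :=
  \sum_(i < 2) \sum_(j < 2) \sum_(k < 2) \sum_(l < 2)
    t (ebasis i) (ebasis j) (ebasis k) (ebasis l)
      *: delta_mx (mxvec_index i j) (mxvec_index k l).

(* The adjacent transpositions generate all permutations of the arguments. *)
Definition totally_symmetric T : Prop :=
  forall X Y Z W, [/\ teval T Y X Z W = teval T X Y Z W,
    teval T X Z Y W = teval T X Y Z W & teval T X Y W Z = teval T X Y Z W].

Definition complex_structures : set 'M[R]_2 :=
  [set J | J *m J = - 1%:M /\ exists X, X != 0 /\ 0 < rho0 X (J *m X)].

Definition gJ J X Y : R := rho0 X (J *m Y).

(* (J, T) ranges over an ambient vector space of dimension 4 + 16. *)
Definition ambient : normedModType R := ('M[R]_2 * 'M[R]_(2 * 2))%type.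

(* A quartic differential q is encoded by T = Re q. *)
Definition quartic_bundle : set ambient :=
  [set p | [/\ complex_structures p.1, totally_symmetric p.2 &
     forall X Y Z W, teval p.2 (p.1 *m X) (p.1 *m Y) Z W = - teval p.2 X Y Z W]].

(* Equivariant flat maximal embeddings correspond to the nonzero quartic
   differentials. *)
Definition MF : set ambient := [set p | quartic_bundle p /\ p.2 != 0].

Definition gram J : 'M[R]_2 := \matrix_(i, j) gJ J (ebasis i) (ebasis j).

(* [raise J T] is g_J^{-1} T; see [raiseP]. *)
Definition raise J T X Y : 'M[R]_2 :=
  invmx (gram J)^T *m (\matrix_(k, l) teval T X Y (ebasis k) (ebasis l))^T.

Lemma sum2 (V : nmodType) (F : 'I_2 -> V) : \sum_i F i = F 0 + F 1.
Proof. by rewrite !big_ord_recl big_ord0 addr0; congr (_ + F _); apply: val_inj. Qed.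

Lemma mulmx2E (m n : nat) (A : 'M[R]_(m, 2)) (B : 'M[R]_(2, n)) i j :
  (A *m B) i j = A i 0 * B 0 j + A i 1 * B 1 j.
Proof. by rewrite mxE sum2. Qed.

Lemma complex_structuresE J : complex_structures J ->
  [/\ J 1 1 = - J 0 0, J 0 0 ^+ 2 + J 0 1 * J 1 0 = - 1 & 0 < J 1 0].
Proof.
case=> JJ [X [_ X0]].
have E i j := congr1 (fun A : 'M[R]_2 => A i j) JJ.
have := E 0 0; have := E 0 1; have := E 1 0.
rewrite !mulmx2E !mxE /= => {E}.
rewrite !mulr0n oppr0 mulr1n.
move: X0; rewrite /rho0 !mulmx2E.
move: (J 0 0) (J 0 1) (J 1 0) (J 1 1) (X 0 0) (X 1 0) => a b c d x y h e10 e01 e00.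
have tJ : d = - a.
  have [/eqP|nz] := eqVneq (a + d) 0; first by rewrite addrC addr_eq0 => /eqP.
  have b0 : b = 0.
    apply: (mulIf nz); rewrite mul0r -e01; ring.
  by have := sqr_ge0 a; rewrite expr2; move: e00; rewrite b0 => e; lra.
subst d; have e : a ^+ 2 + b * c = - 1 by rewrite expr2.
split=> //.
have hc : c * (x * (c * x + - a * y) - y * (a * x + b * y))
          = (c * x - a * y) ^+ 2 + y ^+ 2.
  have -> : y ^+ 2 = - (a ^+ 2 + b * c) * y ^+ 2 by rewrite e opprK mul1r.
  ring.
have : 0 <= c * (x * (c * x + - a * y) - y * (a * x + b * y)).
  by rewrite hc addr_ge0 ?sqr_ge0.
rewrite pmulr_lge0 // le_eqVlt => /orP[/eqP c0|//].
by move: e (sqr_ge0 a); rewrite -c0 mulr0 addr0 => ->; rewrite oppr_ge0 ler10.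
Qed.

Lemma gJE J X Y : complex_structures J -> gJ J X Y =
  J 1 0 * X 0 0 * Y 0 0 - J 0 0 * (X 0 0 * Y 1 0 + X 1 0 * Y 0 0)
  - J 0 1 * X 1 0 * Y 1 0.
Proof.
move=> /complex_structuresE [tJ _ _]; rewrite /gJ /rho0 !mulmx2E tJ; ring.
Qed.

Lemma gram_unit J : complex_structures J -> gram J \in unitmx.
Proof.
move=> cJ; have [tJ dJ _] := complex_structuresE cJ.
pose N : 'M[R]_2 := \matrix_(i, j)
  if i == 0 then (if j == 0 then - J 0 1 else J 0 0)
  else if j == 0 then J 0 0 else J 1 0.
suff /mulmx1_unit[] : gram J *m N = 1%:M by [].
have I2 (i : 'I_2) : i = 0 \/ i = 1.
  by case: i => [[|[|//]] p]; [left|right]; apply: val_inj.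
apply/matrixP => i j; rewrite mulmx2E !mxE !(gJE _ _ cJ) /ebasis !mxE.
move: dJ; move: (J 0 0) (J 0 1) (J 1 0) => a b c dJ.
case: (I2 i) => ->; case: (I2 j) => ->; rewrite /= ?(mulr0n, mulr1n).
- rewrite -[RHS]opprK -dJ; ring.
- ring.
- ring.
- rewrite -[RHS]opprK -dJ; ring.
Qed.

Lemma gram_sum J X Y :
  gJ J X Y = (X^T *m gram J *m Y) 0 0.
Proof.
rewrite !mulmx2E !mxE /gJ /rho0 !mulmx2E /ebasis !mxE /= ?(mulr0n, mulr1n).
move: (J 0 0) (J 0 1) (J 1 0) (J 1 1) (X 0 0) (X 1 0) (Y 0 0) (Y 1 0) => *.
ring.
Qed.

Lemma teval_basis T X Y Z W : teval T X Y Z W =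
  \sum_(k < 2) \sum_(l < 2) teval T X Y (ebasis k) (ebasis l) * Z k 0 * W l 0.
Proof.
rewrite /teval /ebasis !sum2 !mxE /= ?(mulr0n, mulr1n).
ring.
Qed.

Lemma raiseP J T X Y Z W : complex_structures J ->
  gJ J (raise J T X Y *m Z) W = teval T X Y Z W.
Proof.
move=> cJ; have uG := gram_unit cJ; rewrite gram_sum /raise trmx_mul trmx_mul.
rewrite trmxK trmx_inv trmxK -!mulmxA (mulmxA (invmx _)) mulVmx // mul1mx.
rewrite [RHS]teval_basis !sum2 !mulmx2E !mxE.
ring.
Qed.

Definition End_form := 'cV[R]_2 -> 'cV[R]_2 -> 'M[R]_2.
Implicit Types V : End_form.

Definition trace_part V : End_form := fun X Y => (2^-1 * \tr (V X Y)) *: 1%:M.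
Definition traceless_part V : End_form := fun X Y => V X Y - trace_part V X Y.

Definition J_inner (J' J'' : 'M[R]_2) : R := 2^-1 * \tr (J' *m J'').

Definition form_inner_at (e1 e2 : 'cV[R]_2) V V' : R :=
  4^-1 * (\tr (V e1 e1 *m V' e1 e1) + \tr (V e1 e2 *m V' e1 e2)
        + \tr (V e2 e1 *m V' e2 e1) + \tr (V e2 e2 *m V' e2 e2)).

(* The value does not depend on the g_J-unit vector e1 ([form_innerE]); the
   first standard basis vector is normalized to get one. *)
Definition unit_vector J : 'cV[R]_2 :=
  (Num.sqrt (gJ J (ebasis 0) (ebasis 0)))^-1 *: ebasis 0.
Definition form_inner J V V' : R :=
  form_inner_at (unit_vector J) (J *m unit_vector J) V V'.

Lemma gJ_unit_vector J : complex_structures J ->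
  gJ J (unit_vector J) (unit_vector J) = 1.
Proof.
move=> cJ; have [_ _ c0] := complex_structuresE cJ.
have e : gJ J (ebasis 0) (ebasis 0) = J 1 0.
  by rewrite (gJE _ _ cJ) /ebasis !mxE /= ?(mulr0n, mulr1n); ring.
rewrite /unit_vector e (gJE _ _ cJ) /ebasis !mxE /= ?(mulr0n, mulr1n).
rewrite !(mulr0, mulr1, mul0r, addr0, subr0) -mulrA -invfM -expr2.
by rewrite sqr_sqrtr ?ltW // mulfV // gt_eqF.
Qed.

Definition bilinear_form V : Prop :=
  (forall X, linear (V X)) /\ (forall Y, linear (V ^~ Y)).

Lemma raise_bilinear J T : bilinear_form (raise J T).
Proof.
split=> [X a Y Y'|Y a X X']; rewrite /raise.
  rewrite scalemxAr -mulmxDr -linearZ -linearD /=; congr (_ *m _^T).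
  apply/matrixP => i j; rewrite !mxE /teval !sum2 !mxE; ring.
rewrite scalemxAr -mulmxDr -linearZ -linearD /=; congr (_ *m _^T).
apply/matrixP => i j; rewrite !mxE /teval !sum2 !mxE; ring.
Qed.

Lemma form_innerE J V V' e : complex_structures J ->
  bilinear_form V -> bilinear_form V' -> gJ J e e = 1 ->
  form_inner J V V' = form_inner_at e (J *m e) V V'.
Proof.
move=> cJ [Vr Vl] [Vr' Vl'] ee; have [tJ dJ c0] := complex_structuresE cJ.
have uu := gJ_unit_vector cJ; rewrite /form_inner.
move: (unit_vector J) uu => u uu.
pose a := gJ J u e; pose b := gJ J (J *m u) e.
have JJe X : J *m (J *m X) = - X.
  by case: cJ => JJ _; rewrite mulmxA JJ mulNmx mul1mx.
have ue : e = a *: u + b *: (J *m u).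
  have I2 (i : 'I_2) : i = 0 \/ i = 1.
    by case: i => [[|[|//]] p]; [left|right]; apply: val_inj.
  apply/matrixP => i j; rewrite (ord1 j) /a /b; move: uu.
  rewrite !(gJE _ _ cJ) !mxE !sum2 tJ => uu.
  rewrite -[LHS]mul1r -[in LHS]uu; move: dJ => dJ.
  have J01 : J 0 1 = - (1 + J 0 0 ^+ 2) / J 1 0.
    by apply: (mulIf (lt0r_neq0 c0)); rewrite mulfVK ?lt0r_neq0 //; move: dJ; lra.
  by case: (I2 i) => ->; rewrite ?tJ J01; field; rewrite lt0r_neq0.
have Jue : J *m e = a *: (J *m u) + (- b) *: u.
  by rewrite ue mulmxDr -!scalemxAr JJe scalerN scaleNr.
have ab : a ^+ 2 + b ^+ 2 = 1.
  have JuJu : gJ J (J *m u) (J *m u) = 1.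
    by rewrite -uu /gJ JJe /rho0 !mxE; ring.
  rewrite -ee [in RHS]ue -[LHS]mulr1 mulrDl -{1}uu -JuJu.
  rewrite !(gJE _ _ cJ) !mxE !sum2 tJ; ring.
have lin (F : 'cV[R]_2 -> 'M[R]_2) x y c d : linear F ->
    F (c *: x + d *: y) = c *: F x + d *: F y.
  move=> lF; have F0 : F 0 = 0.
    by have := lF (-1) 0 0; rewrite scaler0 addr0 scaleN1r addNr.
  by rewrite lF -[d *: y]addr0 lF F0 addr0.
move: Jue ab; rewrite /form_inner_at ue => ->; clearbody a b => ab {e ee ue}.
rewrite !(lin _ _ _ _ _ (Vr _)) !(lin _ _ _ _ _ (Vr' _)).
rewrite !(lin (V^~ _) _ _ _ _ (Vl _)) !(lin (V'^~ _) _ _ _ _ (Vl' _)).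
move: (J *m u) => v; move: (V u u) (V u v) (V v u) (V v v) => A B C D.
move: (V' u u) (V' u v) (V' v u) (V' v v) => A' B' C' D'.
have trE (x y : R) (M N K : 'M[R]_2) :
    \tr ((x *: M + y *: N) *m K) = x * \tr (M *m K) + y * \tr (N *m K).
  by rewrite mulmxDl -!scalemxAl mxtraceD !mxtraceZ.
have trE' (x y : R) (M N K : 'M[R]_2) :
    \tr (K *m (x *: M + y *: N)) = x * \tr (K *m M) + y * \tr (K *m N).
  by rewrite mulmxDr -!scalemxAr mxtraceD !mxtraceZ.
rewrite !trE !trE'.
move: (\tr (A *m A')) (\tr (B *m B')) (\tr (C *m C')) (\tr (D *m D')) => AA BB CC DD.
move: (\tr (A *m B')) (\tr (A *m C')) (\tr (A *m D')) => AB AC AD.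
move: (\tr (B *m A')) (\tr (B *m C')) (\tr (B *m D')) => BA BC BD.
move: (\tr (C *m A')) (\tr (C *m B')) (\tr (C *m D')) => CA CB CD.
move: (\tr (D *m A')) (\tr (D *m B')) (\tr (D *m C')) => DA DB DC.
match goal with |- _ * ?s = _ => have -> : s = (a ^+ 2 + b ^+ 2) ^+ 2 * s by rewrite ab expr1n mul1r end.
ring.
Qed.

(* Tangent vectors at (J, U) in the form (J', U'), with U' = g_J^{-1} T'. *)
Definition tvec : Type := ('M[R]_2 * End_form)%type.
Definition tangent_rep (p v : ambient) : tvec := (v.1, raise p.1 v.2).

Definition half_norm2 (p : ambient) : R :=
  form_inner p.1 (raise p.1 p.2) (raise p.1 p.2) / 2.

Definition g_f (f : R -> R) (p : ambient) (v w : tvec) : R :=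
  (1 - f (half_norm2 p)) * J_inner v.1 w.1
  + 2^-1 * half_line_derive f (half_norm2 p)
    * (form_inner p.1 (traceless_part v.2) (traceless_part w.2)
     - form_inner p.1 (trace_part v.2) (trace_part w.2)).

Definition cplx_I (p : ambient) (v : tvec) : tvec :=
  (- (p.1 *m v.1),
   fun X Y => - (v.2 X Y *m p.1) - raise p.1 p.2 X Y *m v.1).

Definition omega_f (f : R -> R) (p v w : ambient) : R :=
  g_f f p (tangent_rep p v) (cplx_I p (tangent_rep p w)).

(* q = T - i T(., ., ., J.) *)
Definition quartic_differential (p : ambient) X Y Z W : R[i] :=
  (teval p.2 X Y Z W -i* teval p.2 X Y Z (p.1 *m W))%C.

(* e^(it) sends q to e^(-it) q; the second component is Re (e^(-it) q). *)
Definition S1_act (z : S1 R) (p : ambient) : ambient :=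
  (p.1, tensor (fun X Y Z W =>
     complex.Re ((circle_val z)^-1 * quartic_differential p X Y Z W))).

Definition SL2_act (A : SL2 R) (p : ambient) : ambient :=
  (A *m p.1 *m invmx A,
   tensor (fun X Y Z W =>
     teval p.2 (invmx A *m X) (invmx A *m Y) (invmx A *m Z) (invmx A *m W))).

(* [- A] acts as [A] ([PSL2_act_pi]). *)
Definition PSL2_act (g : PSL2R R) (p : ambient) : ambient := SL2_act (repr g) p.

Lemma PSL2_act_pi (A : SL2 R) p : PSL2_act (\pi_(PSL2 R) A) p = SL2_act A p.
Proof.
rewrite /PSL2_act /SL2_act; case: (PSL2_repr_pi A) => -> //.
have -> : invmx (- SL2_val A) = - invmx (SL2_val A).
  rewrite -scaleN1r invmxZ ?invrN1 ?scaleN1r //.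
  by rewrite -scaleN1r unitmxE detZ sqrrN expr1n mul1r -unitmxE; apply: SL2_unit.
rewrite !mulNmx mulmxN opprK; congr (_, tensor _).
apply/funext => X; apply/funext => Y; apply/funext => Z; apply/funext => W.
rewrite /teval !sum2 !mulNmx !mxE; ring.
Qed.

End Tensors.

(* Main.v *)
Require Import Defs.
From HB Require Import structures.
From mathcomp Require Import all_boot all_order all_algebra.
From mathcomp Require Import complex ring lra.
From mathcomp Require Import all_classical all_reals all_analysis.

(** The complex structure J is the one for which w(X) = X_0 - conj z X_1 is complex
    linear, for a unique z = x + i y in the upper half-plane, and a quartic
    differential is then kappa w^4 with kappa = u + i v. This gives a global
    chart (x, y, u, v) of the bundle ([chart_MF], [MF_chart]), in which MF is
    the set where kappa is not 0, and half of the squared norm of T is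
    t = y^4 |kappa|^2. Writing F = f(t), the form becomes

      omega = - (1 - F) / y^2 dx /\ dy + f'(t) y^4 Re A /\ Im A,
      A = dkappa + 2 i kappa dconj z / y

    ([omega_chart]): the first variation of Re (kappa w^4) is the sum of
    Re (A w^4) and of a mixed term, orthogonal to it, whose traceless part and
    trace part have the same norm. The computation is made at x = 0, which is no
    restriction because omega is invariant under SL(2, R) ([omega_SL2]).

    In polar coordinates kappa = y^{-2} r e^(i phi), where t = r^2,

      omega = d ((F - 1) / y) /\ dx + d (F / 2) /\ dphi,

    so that theta_1 = - phi, H_1 = F / 2, theta_2 = x, H_2 = (1 - F) / y are Darboux
    coordinates ([darboux_form]). They are global ([darboux_diffeomorphism]): f is
    strictly decreasing, hence H_1 determines t with a smooth inverse on the
    open range of f, and then y = (1 - 2 H_1) / H_2 with 1 - F > 0 because F <= 0.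

    The circle translates theta_1, so H_1 generates its action
    ([S1_moment_map]). For PSL(2, R) the moment map is
    mu^xi = (1 - F) tr (xi J): it is equivariant because t is invariant and the
    trace is unchanged by conjugation ([PSL2_moment_equivariant]), and
    dmu^xi = omega (X_xi, .) is checked in the chart ([PSL2_moment_map]), where
    X_xi is dz/dt = b + 2 a z - c z^2, dkappa/dt = 4 kappa (c conj z - a)
    ([is_derive_orbit]). The orbit is differentiable because exp (t xi) is a
    combination of 1 and xi with explicit coefficients ([expmx_traceless]).
    For xi = E_01, which generates the translations of x, mu^xi is H_2.

    Tangent vectors are velocities of curves in MF, hence values of the
    differential of the chart ([tangent_chart]); derivatives along them of
    functions on the ambient space are taken along images of lines of
    coordinates ([derive_coord]). *)

Set Implicit Arguments.
Unset Strict Implicit.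
Unset Printing Implicit Defensive.

Import Order.TTheory GRing.Theory Num.Theory.
Import numFieldNormedType.Exports.

Local Open Scope classical_set_scope.
Local Open Scope ring_scope.

(** * Chain rules *)

Section ChainRule.
Variable R : realType.
Implicit Types U V W : normedModType R.

Lemma near_eq_differentiable V W (F G : V -> W) x :
  (\near x, F x = G x) -> differentiable F x -> differentiable G x.
Proof.
move=> FG dF; have FGx := nbhs_singleton FG.
have GE : G \o shift x = cst (G x) + 'd F x +o_ 0 id.
  apply/eqaddoP => _/posnumP[e].
  have /eqaddoP /(_ e%:num) := diff_locally dF.
  move=> /(_ [gt0 of e%:num]).
  have : \forall h \near 0, F (h + x) = G (h + x).
    by move: FG; rewrite (near_shift 0 x); apply: filterS => h; rewrite /= subr0.
  apply: filter_app2; near=> h => FGh.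
  by rewrite /= !fctE /= FGh FGx.
apply/diff_locallyP; have dE := diff_unique (diff_continuous dF) GE.
by rewrite dE; split=> //; exact: (diff_continuous dF).
Unshelve. all: by end_near. Qed.

Lemma derive_comp V W (g : V -> W) (c : R -> V) (t : R) :
  derivable c t 1 -> differentiable g (c t) ->
  is_derive t 1 (g \o c) ('D_(derive1 c t) g (c t)).
Proof.
move=> /derivable1_diffP dc dg.
have dgc : differentiable (g \o c) t by exact: differentiable_comp.
split; first exact: diff_derivable.
by rewrite deriveE // diff_comp //= deriveE // derive1E'.
Qed.

Lemma derive_comp1 V (g : R -> R) (F : V -> R) x v l :
  differentiable F x -> is_derive (F x) 1 g l ->
  differentiable (g \o F) x /\ 'D_v (g \o F) x = l * 'D_v F x.
Proof.
move=> dF [dg <-]; have dg' : differentiable g (F x) by exact/derivable1_diffP.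
have dgF : differentiable (g \o F) x by exact: differentiable_comp.
split=> //; rewrite !deriveE // diff_comp //=.
by rewrite -[X in 'd g _ X]mulr1 -[LHS]/('d g (F x) ('d F x v *: 1)) linearZ mulrC.
Qed.

Lemma derive_linear V W (L : {linear V -> W}) x v :
  continuous L -> 'D_v L x = L v.
Proof.
by move=> cL; rewrite deriveE ?diff_lin //; exact: linear_differentiable.
Qed.

Lemma derive_linear_comp U V W (L : {linear V -> W}) (F : U -> V) x v :
  continuous L -> differentiable F x -> 'D_v (L \o F) x = L ('D_v F x).
Proof.
move=> cL dF; have dL : differentiable L (F x) by exact: linear_differentiable.
have dLF : differentiable (L \o F) x by exact: differentiable_comp.
by rewrite (deriveE _ dLF) (diff_comp dF dL) /= (diff_lin _ cL) (deriveE _ dF).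
Qed.

End ChainRule.

(** * Closure properties of maps of class C^k *)

Section Smoothness.
Variables (R : realType) (V : normedModType R) (O : set V).
Hypothesis oO : open O.
Implicit Types U W : normedModType R.

(** Derivatives are known in closed form on [O] only; this lemma lets such a
    formula replace ['D_v F] in the inductions on [k] below. *)
Lemma Ck_ext W k (F G : V -> W) :
  (forall x, O x -> F x = G x) -> Ck k O F -> Ck k O G.
Proof.
elim: k F G => [|k IH] F G FG.
  move=> cF x Ox; have FGx := FG x Ox.
  have := cF x Ox; rewrite /prop_for /continuous_at -FGx.
  apply: cvg_trans; apply: near_eq_cvg; near=> y; apply: FG; near: y.
  exact: open_nbhs_nbhs.
have nFG x : O x -> \near x, F x = G x.
  by move=> Ox; near=> y; apply: FG; near: y; exact: open_nbhs_nbhs.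
move=> [dF DF]; split=> [x Ox|v].
  exact: (near_eq_differentiable (nFG x Ox) (dF x Ox)).
apply: (IH _ _ _ (DF v)) => x Ox.
by rewrite (near_eq_derive _ (nFG x Ox)).
Unshelve. all: by end_near. Qed.

Lemma CkW W k (F : V -> W) : Ck k.+1 O F -> Ck k O F.
Proof.
elim: k F => [|k IH] F [dF DF].
  by move=> x Ox; apply: differentiable_continuous; exact: dF.
by split=> // v; apply: IH; exact: DF.
Qed.

Lemma Ck_diff W k (F : V -> W) x : Ck k.+1 O F -> O x -> differentiable F x.
Proof. by move=> [dF _]; exact: dF. Qed.

Lemma Ck_cst W k (w : W) : Ck k O (cst w).
Proof.
elim: k w => [|k IH] w; first by move=> x _; exact: cst_continuous.
split=> [x _|v]; first exact: differentiable_cst.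
by apply: Ck_ext (IH 0) => x _; rewrite derive_cst.
Qed.

Lemma Ck_linear W k (L : {linear V -> W}) : continuous L -> Ck k O L.
Proof.
move=> cL; case: k => [|k]; first by move=> x _; exact: cL.
split=> [x _|v]; first exact: linear_differentiable.
by apply: Ck_ext (Ck_cst k (L v)) => x _; rewrite derive_linear.
Qed.

Lemma Ck_linear_comp U W k (L : {linear U -> W}) (F : V -> U) :
  continuous L -> Ck k O F -> Ck k O (L \o F).
Proof.
move=> cL; elim: k F => [|k IH] F.
  by move=> cF x Ox; apply: continuous_comp; [exact: cF|exact: cL].
move=> [dF DF]; split=> [x Ox|v].
  by apply: differentiable_comp; [exact: dF|exact: linear_differentiable].
apply: Ck_ext (IH _ (DF v)) => x Ox.
by rewrite derive_linear_comp //; exact: dF.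
Qed.

Lemma CkD W k (F G : V -> W) : Ck k O F -> Ck k O G -> Ck k O (F \+ G).
Proof.
elim: k F G => [|k IH] F G.
  by move=> cF cG x Ox; apply: continuousD; [exact: cF|exact: cG].
move=> [dF DF] [dG DG]; split=> [x Ox|v].
  by apply: differentiableD; [exact: dF|exact: dG].
apply: Ck_ext (IH _ _ (DF v) (DG v)) => x Ox.
by rewrite deriveD //; apply: diff_derivable; [exact: dF|exact: dG].
Qed.

Lemma CkN W k (F : V -> W) : Ck k O F -> Ck k O (fun x => - F x).
Proof.
elim: k F => [|k IH] F.
  by move=> cF x Ox; apply: continuousN; exact: cF.
move=> [dF DF]; split=> [x Ox|v].
  by apply: differentiableN; exact: dF.
apply: Ck_ext (IH _ (DF v)) => x Ox.
by rewrite deriveN //; apply: diff_derivable; exact: dF.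
Qed.

Lemma CkM k (F G : V -> R) : Ck k O F -> Ck k O G -> Ck k O (F \* G).
Proof.
elim: k F G => [|k IH] F G.
  by move=> cF cG x Ox; apply: continuousM; [exact: cF|exact: cG].
move=> cF cG; have [dF DF] := cF; have [dG DG] := cG; split=> [x Ox|v].
  by apply: differentiableM; [exact: dF|exact: dG].
apply: Ck_ext (CkD (IH _ _ (CkW cF) (DG v)) (IH _ _ (CkW cG) (DF v))) => x Ox.
by rewrite deriveM //; apply: diff_derivable; [exact: dF|exact: dG].
Qed.

(** One step of an induction on the order: as D_v (g o F) = (g' o F) D_v F, the
    map g o F gains an order as soon as g' o F is under control at the previous
    one. The next lemmas differ in how g' is expressed through g. *)
Lemma Ck_comp1 k (g dg : R -> R) (F : V -> R) :
  (forall x, O x -> is_derive (F x) 1 g (dg (F x))) ->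
  (Ck k O (g \o F) -> Ck k O (dg \o F)) ->
  Ck k.+1 O F -> Ck k O (g \o F) -> Ck k.+1 O (g \o F).
Proof.
move=> dgP gdg cF cg; split=> [x Ox|v].
  by have [] := derive_comp1 0 (Ck_diff cF Ox) (dgP x Ox).
have := CkM (gdg cg) (cF.2 v).
apply: Ck_ext => x Ox; by have [_ ->] := derive_comp1 v (Ck_diff cF Ox) (dgP x Ox).
Qed.

Lemma CkV k (F : V -> R) : (forall x, O x -> F x != 0) ->
  Ck k O F -> Ck k O (fun x => (F x)^-1).
Proof.
move=> F0; elim: k F F0 => [|k IH] F F0.
  by move=> cF x Ox; apply: continuousV; [exact: F0|exact: cF].
move=> cF; have [dF DF] := cF; split=> [x Ox|v].
  by apply: differentiableV; [exact: dF|exact: F0].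
have cV := IH _ F0 (CkW cF).
apply: Ck_ext (CkN (CkM (CkM cV cV) (DF v))) => x Ox /=.
rewrite deriveV //; first by rewrite expr2 invfM scaleNr.
- exact: F0.
- by apply: diff_derivable; exact: dF.
Qed.

Lemma Ck_lin W U k (L : U -> W) (F : V -> U) :
  linear L -> continuous L -> Ck k O F -> Ck k O (fun x => L (F x)).
Proof.
move=> linL cL cF.
pose ML := GRing.isLinear.Build _ _ _ _ _ linL.
pose LL : {linear U -> W} := HB.pack L ML.
exact: (@Ck_linear_comp _ _ k LL).
Qed.

Lemma Ck_scalel W k (F : V -> R) (w : W) :
  Ck k O F -> Ck k O (fun x => F x *: w).
Proof.
apply: (Ck_lin (L := fun a : R => a *: w)); last exact: scalel_continuous.
by move=> a u v; rewrite scalerDl scalerA.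
Qed.

Lemma Ck_scale k (a : R) (F : V -> R) : Ck k O F -> Ck k O (fun x => a * F x).
Proof. by move=> cF; apply: CkM => //; exact: Ck_cst. Qed.

Lemma CkX k n (F : V -> R) : Ck k O F -> Ck k O (fun x => F x ^+ n).
Proof.
move=> cF; elim: n => [|n IH]; first exact: (Ck_cst k (1 : R)).
by apply: Ck_ext (CkM cF IH) => x _ /=; rewrite exprS.
Qed.

Lemma Ck_sum W k n (F : 'I_n -> V -> W) :
  (forall i, Ck k O (F i)) -> Ck k O (fun x => \sum_(i < n) F i x).
Proof.
move=> cF; elim: n F cF => [|n IH] F cF.
  by apply: Ck_ext (Ck_cst k 0) => x _; rewrite big_ord0.
apply: Ck_ext (CkD (cF ord0) (IH _ (fun i => cF (lift ord0 i)))) => x _.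
by rewrite /= big_ord_recl.
Qed.

Lemma Ck_mx k m n (F : V -> 'M[R]_(m, n)) :
  (forall i j, Ck k O (fun x => F x i j)) -> Ck k O F.
Proof.
move=> cF.
have cS := Ck_sum (fun i => Ck_sum (fun j => Ck_scalel (delta_mx i j) (cF i j))).
by apply: Ck_ext cS => x _ /=; rewrite -matrix_sum_delta.
Qed.

Lemma Ck_coord k m n (F : V -> 'M[R]_(m, n)) i j :
  Ck k O F -> Ck k O (fun x => F x i j).
Proof.
apply: (Ck_lin (L := fun M : 'M[R]_(m, n) => M i j)); last exact: coord_continuous.
by move=> a A B; rewrite !mxE.
Qed.

Lemma Ck_pair W U k (F : V -> W) (G : V -> U) :
  Ck k O F -> Ck k O G -> Ck k O (fun x => (F x, G x)).
Proof.
move=> cF cG.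
have c1 : Ck k O (fun x => (F x, 0 : U)).
  apply: (Ck_lin (L := fun w : W => (w, 0 : U))) cF.
    move=> a u v; by congr (_, _); rewrite /= ?scaler0 ?addr0.
  by move=> x; apply: cvg_pair; [exact: cvg_id|exact: cvg_cst].
have c2 : Ck k O (fun x => (0 : W, G x)).
  apply: (Ck_lin (L := fun w : U => (0 : W, w))) cG.
    move=> a u v; by congr (_, _); rewrite /= ?scaler0 ?addr0.
  by move=> x; apply: cvg_pair; [exact: cvg_cst|exact: cvg_id].
apply: Ck_ext (CkD c1 c2) => x _ /=.
by congr (_, _); rewrite ?addr0 ?add0r.
Qed.

Lemma Ck_fst W U k (F : V -> W * U) : Ck k O F -> Ck k O (fun x => (F x).1).
Proof. by apply: (Ck_lin (L := fst)) => //; move=> x; exact: cvg_fst. Qed.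

Lemma Ck_snd W U k (F : V -> W * U) : Ck k O F -> Ck k O (fun x => (F x).2).
Proof. by apply: (Ck_lin (L := snd)) => //; move=> x; exact: cvg_snd. Qed.

Lemma Ck_id k : Ck k O (id : V -> V).
Proof. exact: (Ck_linear k (L := idfun)) (fun x => cvg_id). Qed.

(** The successive derivatives of [g 0] are given as a sequence because those of
    a function on the half-line are one-sided, and are known to be derivatives
    in the usual sense only at the points that [F] takes as values. *)
Lemma Ck_tower k n (g : nat -> R -> R) (F : V -> R) :
  (forall m x, O x -> is_derive (F x) 1 (g m) (g m.+1 (F x))) ->
  Ck k O F -> Ck k O (g n \o F).
Proof.
move=> gP; elim: k n => [|k IH] n cF.
  move=> x Ox; apply: continuous_comp; first exact: cF.
  by apply: differentiable_continuous; apply/derivable1_diffP; have [] := gP n x Ox.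
by apply: (Ck_comp1 (gP n)) => //; [move=> _; apply: IH|apply: IH]; exact: CkW.
Qed.

Lemma Ck_sqrt k (F : V -> R) : (forall x, O x -> 0 < F x) ->
  Ck k O F -> Ck k O (fun x => Num.sqrt (F x)).
Proof.
move=> F0; elim: k => [|k IH] cF.
  by move=> x Ox; apply: (continuous_comp (cF x Ox)); exact: sqrt_continuous.
apply: (@Ck_comp1 k Num.sqrt (fun t => (2 * Num.sqrt t)^-1)) (cF) _ => //.
- by move=> x Ox; apply: is_derive1_sqrt; exact: F0.
- move=> cs; apply: CkV; last exact: Ck_scale.
  by move=> x Ox; rewrite mulf_neq0 // gt_eqF // sqrtr_gt0 F0.
- by apply: IH; exact: CkW.
Qed.

(** Here [h] inverts [g 0], and h' = 1 / (g' o h) has the regularity of [h]. *)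
Lemma Ck_inverse k (g : nat -> R -> R) (h : R -> R) (F : V -> R) :
  (forall x, O x -> is_derive (F x) 1 h (g 1%N (h (F x)))^-1) ->
  (forall x, O x -> g 1%N (h (F x)) != 0) ->
  (forall m x, O x -> is_derive (h (F x)) 1 (g m) (g m.+1 (h (F x)))) ->
  Ck k O F -> Ck k O (h \o F).
Proof.
move=> hP g0 gP; elim: k => [|k IH] cF.
  move=> x Ox; apply: continuous_comp; first exact: cF.
  by apply: differentiable_continuous; apply/derivable1_diffP; have [] := hP x Ox.
apply: (@Ck_comp1 k h (fun t => (g 1%N (h t))^-1)) (cF) _ => //.
- move=> ch; apply: (CkV (F := g 1%N \o (h \o F))) => //.
  exact: Ck_tower ch.
- by apply: IH; exact: CkW.
Qed.

End Smoothness.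

(** * Components of tensors of type (0,4) *)

Section TensorComponents.
Variable R : realType.
Implicit Types (T : 'M[R]_(2 * 2)) (X Y Z W : 'cV[R]_2).

Lemma ord2P (i : 'I_2) : i = 0 \/ i = 1.
Proof. by case: i => [[|[|//]] p]; [left|right]; apply: val_inj. Qed.

Lemma mxvec_index_eq (i j i' j' : 'I_2) :
  (mxvec_index i j == mxvec_index i' j') = (i == i') && (j == j').
Proof.
by rewrite /mxvec_index (inj_eq (@cast_ord_inj _ _ _)) (inj_eq enum_rank_inj) xpair_eqE.
Qed.

Lemma mx22P (M N : 'M[R]_(2 * 2)) :
  (forall i j k l, M (mxvec_index i j) (mxvec_index k l) =
                   N (mxvec_index i j) (mxvec_index k l)) -> M = N.
Proof.
move=> MN; apply/matrixP => a b.
by case/mxvec_indexP: a => i j; case/mxvec_indexP: b => k l.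
Qed.

Lemma sum_delta4 (F : 'I_2 -> 'I_2 -> 'I_2 -> 'I_2 -> R) i j k l :
  (\sum_(i < 2) \sum_(j < 2) \sum_(k < 2) \sum_(l < 2)
     F i j k l *: delta_mx (mxvec_index i j) (mxvec_index k l) : 'M[R]_(2 * 2))
    (mxvec_index i j) (mxvec_index k l) = F i j k l.
Proof.
rewrite !sum2 !mxE !mxvec_index_eq.
case: (ord2P i) => ->; case: (ord2P j) => ->; case: (ord2P k) => ->;
  case: (ord2P l) => ->; rewrite /= ?mulr0n ?mulr1n; ring.
Qed.

Lemma tensorE t i j k l :
  tensor t (mxvec_index i j) (mxvec_index k l) =
  t (ebasis R i) (ebasis R j) (ebasis R k) (ebasis R l).
Proof. exact: sum_delta4. Qed.

Lemma ebasisE (i j : 'I_2) : ebasis R i j 0 = (j == i)%:R.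
Proof. by rewrite mxE andbT. Qed.

Lemma teval_ebasis T i j k l :
  teval T (ebasis R i) (ebasis R j) (ebasis R k) (ebasis R l) =
  T (mxvec_index i j) (mxvec_index k l).
Proof.
rewrite /teval !sum2 !ebasisE.
case: (ord2P i) => ->; case: (ord2P j) => ->; case: (ord2P k) => ->;
  case: (ord2P l) => ->; rewrite /= ?mulr0n ?mulr1n; ring.
Qed.

Definition multilinear (t : 'cV[R]_2 -> 'cV[R]_2 -> 'cV[R]_2 -> 'cV[R]_2 -> R) :=
  [/\ forall Y Z W a X X', t (a *: X + X') Y Z W = a * t X Y Z W + t X' Y Z W,
      forall X Z W a Y Y', t X (a *: Y + Y') Z W = a * t X Y Z W + t X Y' Z W,
      forall X Y W a Z Z', t X Y (a *: Z + Z') W = a * t X Y Z W + t X Y Z' W &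
      forall X Y Z a W W', t X Y Z (a *: W + W') = a * t X Y Z W + t X Y Z W'].

Lemma teval_multilinear T : multilinear (teval T).
Proof. by split=> *; rewrite /teval !sum2 !mxE; ring. Qed.

Lemma col2E X : X = X 0 0 *: ebasis R 0 + X 1 0 *: ebasis R 1.
Proof.
apply/matrixP => i j; rewrite (ord1 j) !mxE.
case: (ord2P i) => -> /=; ring.
Qed.

Lemma teval_tensor t X Y Z W : multilinear t -> teval (tensor t) X Y Z W = t X Y Z W.
Proof.
move=> [t1 t2 t3 t4].
have lin (g : 'cV[R]_2 -> R) V : (forall a U U', g (a *: U + U') = a * g U + g U') ->
    g V = V 0 0 * g (ebasis R 0) + V 1 0 * g (ebasis R 1).
  move=> gl; have g0 : g 0 = 0 by have := gl (-1) 0 0; rewrite scaler0 addr0; lra.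
  rewrite [in LHS](col2E V) gl; congr (_ + _).
  by rewrite -[X in g X]addr0 gl g0 addr0.
rewrite /teval !sum2 !tensorE.
rewrite (lin (fun X => t X Y Z W)) //.
rewrite !(lin (fun Y => t _ Y Z W) Y) // !(lin (fun Z => t _ _ Z W) Z) //.
rewrite !(lin (t _ _ _) W) //; ring.
Qed.

(** A component of a totally symmetric tensor depends only on the number of
    its indices that are 1. *)
Definition symmetric_tensor (P : nat -> R) : 'M[R]_(2 * 2) :=
  \sum_(i < 2) \sum_(j < 2) \sum_(k < 2) \sum_(l < 2)
    P (i + j + k + l)%N *: delta_mx (mxvec_index i j) (mxvec_index k l).

Lemma symmetric_tensorE P i j k l :
  symmetric_tensor P (mxvec_index i j) (mxvec_index k l) = P (i + j + k + l)%N.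
Proof. exact: (sum_delta4 (fun i j k l : 'I_2 => P (i + j + k + l)%N)). Qed.

Lemma teval_symmetric_tensor P X Y Z W :
  teval (symmetric_tensor P) X Y Z W =
    P 0 * X 0 0 * Y 0 0 * Z 0 0 * W 0 0
  + P 1 * (X 1 0 * Y 0 0 * Z 0 0 * W 0 0 + X 0 0 * Y 1 0 * Z 0 0 * W 0 0
         + X 0 0 * Y 0 0 * Z 1 0 * W 0 0 + X 0 0 * Y 0 0 * Z 0 0 * W 1 0)
  + P 2 * (X 1 0 * Y 1 0 * Z 0 0 * W 0 0 + X 1 0 * Y 0 0 * Z 1 0 * W 0 0
         + X 1 0 * Y 0 0 * Z 0 0 * W 1 0 + X 0 0 * Y 1 0 * Z 1 0 * W 0 0
         + X 0 0 * Y 1 0 * Z 0 0 * W 1 0 + X 0 0 * Y 0 0 * Z 1 0 * W 1 0)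
  + P 3 * (X 1 0 * Y 1 0 * Z 1 0 * W 0 0 + X 1 0 * Y 1 0 * Z 0 0 * W 1 0
         + X 1 0 * Y 0 0 * Z 1 0 * W 1 0 + X 0 0 * Y 1 0 * Z 1 0 * W 1 0)
  + P 4 * X 1 0 * Y 1 0 * Z 1 0 * W 1 0.
Proof.
by rewrite /teval !sum2 !symmetric_tensorE /=; ring.
Qed.

End TensorComponents.

(** * The global chart (z, kappa) *)

Section Chart.
Variable R : realType.

(** z = x + i y is a point of the upper half-plane, and kappa = u + i v is the
    coefficient of the quartic differential kappa w^4. *)
Record coords := Coords { cx : R; cy : R; cu : R; cv : R }.

(** The complex structure for which w(X) = X_0 - conj z X_1 is complex
    linear. *)
Definition cplx_structure (q : coords) : 'M[R]_2 := \matrix_(i, j)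
  if i == 0 then (if j == 0 then cx q / cy q
                  else - ((cx q ^+ 2 + cy q ^+ 2) / cy q))
  else if j == 0 then (cy q)^-1 else - (cx q / cy q).

(** Real and imaginary parts of kappa (- conj z)^n, the value of kappa w^4 when n
    of its arguments are e_1 and the others are e_0: indeed w(e_0) = 1 and
    w(e_1) = - conj z. *)
Fixpoint quartic_coef (q : coords) (n : nat) : R * R :=
  if n is n'.+1 then
    let c := quartic_coef q n' in
    (- cx q * c.1 - cy q * c.2, cy q * c.1 - cx q * c.2)
  else (cu q, cv q).

Definition chart (q : coords) : ambient R :=
  (cplx_structure q, symmetric_tensor (fun n => (quartic_coef q n).1)).

Definition chart_dom (q : coords) := 0 < cy q /\ 0 < cu q ^+ 2 + cv q ^+ 2.

(** Re kappa = T(e_0, e_0, e_0, e_0), and Im kappa = - T(e_0, e_0, e_0, J e_0)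
    because w(J e_0) = i. *)
Definition chart_inv (p : ambient R) : coords :=
  let T i := p.2 (mxvec_index 0 0) (mxvec_index 0 i) in
  Coords (p.1 0 0 / p.1 1 0) (p.1 1 0)^-1 (T 0)
    (- (p.1 1 0 * T 1 + p.1 0 0 * T 0)).

Lemma chartK q : cy q != 0 -> chart_inv (chart q) = q.
Proof.
case: q => x y u v /= y0; rewrite /chart_inv /= !symmetric_tensorE !mxE /=.
by congr Coords; field.
Qed.

Lemma cplx_structure_complex q : 0 < cy q -> complex_structures (cplx_structure q).
Proof.
move=> y0; have yn : cy q != 0 by rewrite gt_eqF.
split.
  apply/matrixP => i j; rewrite mulmx2E !mxE.
  by case: (ord2P i) => ->; case: (ord2P j) => -> /=; rewrite ?mulr0n ?mulr1n; field.
exists (ebasis R 0); split.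
  by apply/eqP => /matrixP /(_ 0 0) /eqP; rewrite ebasisE !mxE oner_eq0.
rewrite /rho0 !mulmx2E !ebasisE !mxE /= !(mulr0, mul1r, mulr1, addr0, subr0, mul0r).
by rewrite invr_gt0.
Qed.

Lemma chart_MF q : chart_dom q -> MF (chart q).
Proof.
move=> [y0 k0]; have yn : cy q != 0 by rewrite gt_eqF.
split; first split.
- exact: cplx_structure_complex.
- by move=> X Y Z W; split; rewrite /= !teval_symmetric_tensor; ring.
- move=> X Y Z W; rewrite /= !teval_symmetric_tensor !mulmx2E !mxE /=; by field.
- apply/eqP => T0; move: k0.
  have E i := congr1 (fun M : 'M[R]_(2 * 2) => M (mxvec_index 0 0) (mxvec_index 0 i)) T0.
  have := E 1; have := E 0; rewrite !symmetric_tensorE !mxE /= => ->.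
  rewrite mulr0 sub0r => /eqP; rewrite oppr_eq0 mulf_eq0 (negPf yn) /= => /eqP ->.
  by rewrite expr0n addr0 ltxx.
Qed.

(** The condition on J at (e_0, e_0) expresses T_11kl through T_00kl and T_01kl.
    Hence T is determined by T_0000 and T_0001, from which [chart_inv] computes
    kappa. *)
Lemma MF_chart p : MF p -> chart_dom (chart_inv p) /\ chart (chart_inv p) = p.
Proof.
case: p => J T [[/= cJ sT JT] T0].
have [d11 dJ c0] := complex_structuresE cJ; have cn : J 1 0 != 0 by rewrite gt_eqF.
have b01 : J 0 1 = - (1 + J 0 0 ^+ 2) / J 1 0.
  by apply: (mulIf cn); rewrite mulfVK //; move: dJ; lra.
pose S i j k l := T (mxvec_index i j) (mxvec_index k l).
have S1 i j k l : S j i k l = S i j k l.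
  have [+ _ _] := sT (ebasis R i) (ebasis R j) (ebasis R k) (ebasis R l).
  by rewrite !teval_ebasis.
have S2 i j k l : S i k j l = S i j k l.
  have [_ + _] := sT (ebasis R i) (ebasis R j) (ebasis R k) (ebasis R l).
  by rewrite !teval_ebasis.
have S3 i j k l : S i j l k = S i j k l.
  have [_ _ +] := sT (ebasis R i) (ebasis R j) (ebasis R k) (ebasis R l).
  by rewrite !teval_ebasis.
have SJ k l : S 1 1 k l =
    - ((1 + J 0 0 ^+ 2) * S 0 0 k l + 2 * J 0 0 * J 1 0 * S 0 1 k l) / J 1 0 ^+ 2.
  have := JT (ebasis R 0) (ebasis R 0) (ebasis R k) (ebasis R l).
  rewrite teval_ebasis /teval !sum2 !mulmx2E !ebasisE.
  rewrite -!/(S _ _ _ _) !(S1 0 1) => e.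
  apply: (mulIf (expf_neq0 2 cn)); rewrite mulfVK ?expf_neq0 //; move: e.
  by case: (ord2P k) => ->; case: (ord2P l) => -> /=; rewrite ?mulr0n ?mulr1n; lra.
have TE : forall i j k l, T (mxvec_index i j) (mxvec_index k l) =
   (quartic_coef (chart_inv (J, T)) (i + j + k + l)%N).1.
  have e0010 := S3 0 0 0 1; have e0100 := etrans (S2 0 0 1 0) e0010.
  have e1000 := etrans (S1 0 1 0 0) e0100.
  have a2 := SJ 0 0; rewrite e0100 in a2.
  have e1010 := etrans (S2 1 1 0 0) a2; have e0110 := etrans (S1 1 0 1 0) e1010.
  have e1001 := etrans (S3 1 0 1 0) e1010; have e0101 := etrans (S1 1 0 0 1) e1001.
  have e0011 := etrans (S2 0 1 0 1) e0101.
  have a3 := SJ 0 1; rewrite e0101 in a3.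
  have e1110 := etrans (S3 1 1 0 1) a3; have e1011 := etrans (S2 1 1 0 1) a3.
  have e0111 := etrans (S1 1 0 1 1) e1011.
  have a4 := SJ 1 1; rewrite e0011 e0111 in a4.
  move=> i j k l; rewrite -/(S i j k l).
  case: (ord2P i) => ->; case: (ord2P j) => ->; case: (ord2P k) => ->;
    case: (ord2P l) => ->;
    rewrite ?(e0010, e0100, e1000, a2, e1010, e0110, e1001, e0101, e0011,
      a3, e1110, e1011, e0111, a4) /= -!/(S _ _ _ _); by field.
have y0 : 0 < cy (chart_inv (J, T)) by rewrite /= invr_gt0.
have TC : chart (chart_inv (J, T)) = (J, T).
  congr (_, _); last by apply: mx22P => i j k l; rewrite symmetric_tensorE TE.
  apply/matrixP => i j; rewrite !mxE /=.
  case: (ord2P i) => ->; case: (ord2P j) => -> /=; rewrite ?d11 ?b01; by field.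
split=> //; split=> //.
rewrite lt_neqAle addr_ge0 ?sqr_ge0 // andbT eq_sym paddr_eq0 ?sqr_ge0 //.
rewrite !sqrf_eq0; apply/negP => /andP[/eqP u0 /eqP v0]; move/negP: T0; apply.
apply/eqP; apply: mx22P => i j k l; rewrite TE [RHS]mxE.
have : quartic_coef (chart_inv (J, T)) (i + j + k + l) = (0, 0).
  elim: (i + j + k + l)%N => [|n IH]; first by rewrite /= -{1}u0 -v0.
  by rewrite /= IH /= !mulr0 !subr0.
by move=> ->.
Qed.

End Chart.

(** * Derivatives of functions of one real variable *)

Section PointwiseDerivatives.
Variable R : realType.
Implicit Types (f g : R -> R) (t : R).

Lemma is_derive_add f g t a b : is_derive t 1 f a -> is_derive t 1 g b ->
  is_derive t 1 (fun s => f s + g s) (a + b).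
Proof. by move=> fa gb; exact: is_deriveD. Qed.

Lemma is_derive_opp f t a : is_derive t 1 f a -> is_derive t 1 (fun s => - f s) (- a).
Proof. by move=> fa; exact: is_deriveN. Qed.

Lemma is_derive_mul f g t a b : is_derive t 1 f a -> is_derive t 1 g b ->
  is_derive t 1 (fun s => f s * g s) (a * g t + f t * b).
Proof.
move=> fa gb; apply: (is_derive_eq (is_deriveM _ _)).
by rewrite addrC [a * _]mulrC.
Qed.

Lemma is_derive_inv f t a : is_derive t 1 f a -> f t != 0 ->
  is_derive t 1 (fun s => (f s)^-1) (- a / f t ^+ 2).
Proof.
move=> [fa <-] f0; split; first exact: derivableV.
by rewrite deriveV // /GRing.scale /= mulNr mulrC -mulNr.
Qed.

Lemma is_derive_const (c t : R) : is_derive t 1 (fun=> c) 0.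
Proof. exact: is_derive_cst. Qed.

Lemma is_derive_chain f g t a b : is_derive t 1 f a -> is_derive (f t) 1 g b ->
  is_derive t 1 (fun s => g (f s)) (b * a).
Proof.
move=> [fa <-] gb; have /derivable1_diffP df := fa.
have [dgf e] := derive_comp1 (1 : R) df gb.
by split; [exact: diff_derivable|rewrite -e].
Qed.

Lemma is_derive_mx m n (M : R -> 'M[R]_(m, n)) (D : 'M[R]_(m, n)) t :
  (forall i j, is_derive t 1 (fun s => M s i j) (D i j)) -> is_derive t 1 M D.
Proof.
move=> MD; have dM : derivable M t 1.
  by apply/derivable_mxP => i j; have [] := MD i j.
split=> //; rewrite derive_mx //; apply/matrixP => i j; rewrite mxE.
by have [_ ->] := MD i j.
Qed.

Lemma is_derive_pair (V W : normedModType R) (F : R -> V) (G : R -> W) t a b :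
  is_derive t 1 F a -> is_derive t 1 G b ->
  is_derive t 1 (fun s => (F s, G s)) (a, b).
Proof.
move=> [/derivable1_diffP dF <-] [/derivable1_diffP dG <-].
have dP : differentiable (fun s => (F s, G s)) t by exact: differentiable_pair.
split; first exact/derivable1_diffP.
by rewrite deriveE // diff_pair // !deriveE.
Qed.

End PointwiseDerivatives.

(** * The differential of the chart and the tangent vectors *)

Section ChartDerivative.
Variable R : realType.
Implicit Types q d : coords R.

Definition d_cplx_structure (q d : coords R) : 'M[R]_2 :=
  let a := cx d / cy q - cx q * cy d / cy q ^+ 2 in
  \matrix_(i, j)
  if i == 0 then (if j == 0 then a
                  else (cx q ^+ 2 / cy q ^+ 2 - 1) * cy d - 2 * cx q * cx d / cy q)
  else if j == 0 then - cy d / cy q ^+ 2 else - a.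

(** Leibniz' rule in the recursion that defines [quartic_coef]. *)
Fixpoint d_quartic_coef (q d : coords R) (n : nat) : R * R :=
  if n is n'.+1 then
    let c := quartic_coef q n' in let dc := d_quartic_coef q d n' in
    (- cx d * c.1 - cx q * dc.1 - cy d * c.2 - cy q * dc.2,
     cy d * c.1 + cy q * dc.1 - cx d * c.2 - cx q * dc.2)
  else (cu d, cv d).

Definition d_chart (q d : coords R) : ambient R :=
  (d_cplx_structure q d, symmetric_tensor (fun n => (d_quartic_coef q d n).1)).

Definition is_derive_coords (c : R -> coords R) (t : R) (d : coords R) :=
  [/\ is_derive t 1 (fun s => cx (c s)) (cx d), is_derive t 1 (fun s => cy (c s)) (cy d),
      is_derive t 1 (fun s => cu (c s)) (cu d) & is_derive t 1 (fun s => cv (c s)) (cv d)].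

Lemma is_derive_quartic_coef (c : R -> coords R) t d n :
  is_derive_coords c t d ->
  is_derive t 1 (fun s => (quartic_coef (c s) n).1) (d_quartic_coef (c t) d n).1 /\
  is_derive t 1 (fun s => (quartic_coef (c s) n).2) (d_quartic_coef (c t) d n).2.
Proof.
move=> [dx dy du dv]; elim: n => [|n [IH1 IH2]]; first by split.
by split; apply: is_derive_eq; rewrite /GRing.scale /=; ring.
Qed.

Lemma is_derive_cplx_structure (c : R -> coords R) t d i j :
  cy (c t) != 0 -> is_derive_coords c t d ->
  is_derive t 1 (fun s => cplx_structure (c s) i j) (d_cplx_structure (c t) d i j).
Proof.
move=> y0 [dx dy _ _]; rewrite !mxE; under eq_fun do rewrite mxE.
have dyV := is_derive_inv dy y0.
case: (ord2P i) => ->; case: (ord2P j) => -> /=.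
- by apply: is_derive_eq; rewrite /GRing.scale /=; field.
- by apply: is_derive_eq; rewrite /GRing.scale /=; field.
- exact: dyV.
- by apply: is_derive_eq; rewrite /GRing.scale /=; field.
Qed.

Lemma is_derive_chart (c : R -> coords R) t d :
  cy (c t) != 0 -> is_derive_coords c t d ->
  is_derive t 1 (fun s => chart (c s)) (d_chart (c t) d).
Proof.
move=> y0 dc; apply: is_derive_pair; last first.
  apply: is_derive_mx => a b.
  case/mxvec_indexP: a => i j; case/mxvec_indexP: b => k l.
  rewrite symmetric_tensorE.
  under eq_fun do rewrite symmetric_tensorE.
  exact: (is_derive_quartic_coef _ dc).1.
by apply: is_derive_mx => i j; exact: is_derive_cplx_structure.
Qed.

Definition affine_coords (q d : coords R) (s : R) : coords R :=
  Coords (cx q + s * cx d) (cy q + s * cy d) (cu q + s * cu d) (cv q + s * cv d).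

Lemma is_derive_affine (a b t : R) : is_derive t 1 (fun s : R => a + s * b) b.
Proof.
by apply: is_derive_eq; rewrite /GRing.scale /=; ring.
Qed.

Lemma is_derive_affine_coords q d t : is_derive_coords (affine_coords q d) t d.
Proof. by split; exact: is_derive_affine. Qed.

Lemma affine_coords0 q d : affine_coords q d 0 = q.
Proof. by case: q => x y u v; rewrite /affine_coords /= !mul0r !addr0. Qed.

Lemma is_derive_chart_line q d : cy q != 0 ->
  is_derive (0 : R) 1 (fun s => chart (affine_coords q d s)) (d_chart q d).
Proof.
move=> y0; rewrite -{2}(affine_coords0 q d).
by apply: is_derive_chart; rewrite ?affine_coords0 //; exact: is_derive_affine_coords.
Qed.

(** The derivative along a tangent vector depends only on the restriction to a
    curve with that velocity, such as the image of a line of coordinates. *)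
Lemma derive_chart (W : normedModType R) (F : ambient R -> W) q d l :
  cy q != 0 -> differentiable F (chart q) ->
  is_derive (0 : R) 1 (fun s => F (chart (affine_coords q d s))) l ->
  'D_(d_chart q d) F (chart q) = l.
Proof.
move=> y0 dF [_ <-]; have [dc De] := is_derive_chart_line d y0.
rewrite -(affine_coords0 q d) in dF.
have [_ ->] := derive_comp dc dF.
by rewrite derive1E De affine_coords0.
Qed.

(** A curve in MF is the image under the chart of the curve of its coordinates,
    which is as differentiable as the curve itself. *)
Lemma tangent_chart q v : chart_dom q -> tangent (@MF R) (chart q) v ->
  exists d, v = d_chart q d.
Proof.
move=> [y0 k0] [S [c [oS S0 sc cM [c0 <-]]]].
have dJ i j : derivable (fun s => (c s).1 i j) 0 1.
  have [dJ _] := Ck_coord oS i j (Ck_fst oS (sc 1%N)).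
  by apply/derivable1_diffP; exact: dJ.
have dT i j : derivable (fun s => (c s).2 i j) 0 1.
  have [dT _] := Ck_coord oS i j (Ck_snd oS (sc 1%N)).
  by apply/derivable1_diffP; exact: dT.
have D (f : R -> R) : derivable f 0 1 -> is_derive (0 : R) 1 f ('D_1 f 0 : R) by move=> df; split.
have c10 : (c 0).1 1 0 != 0.
  by rewrite c0 /= mxE /= invr_eq0 gt_eqF.
pose e s := chart_inv (c s).
have [d de] : exists d, is_derive_coords e 0 d.
  refine (ex_intro _ (Coords _ _ _ _) _); split=> /=.
  - apply: is_derive_mul; first exact: D (dJ 0 0).
    by apply: is_derive_inv c10; exact: D (dJ 1 0).
  - by apply: is_derive_inv c10; exact: D (dJ 1 0).
  - exact: D (dT _ _).
  - apply: is_derive_opp; apply: is_derive_add; apply: is_derive_mul.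
    + exact: D (dJ 1 0).
    + exact: D (dT _ _).
    + exact: D (dJ 0 0).
    + exact: D (dT _ _).
exists d; have eq0 : e 0 = q by rewrite /e /= c0 chartK // gt_eqF.
have : is_derive (0 : R) 1 (fun s => chart (e s)) (d_chart (e 0) d).
  by apply: is_derive_chart => //; rewrite eq0 gt_eqF.
rewrite eq0 => H; rewrite derive1E; apply: derive_val.
apply: near_eq_is_derive H; near=> s.
have Ss : S s by near: s; exact: open_nbhs_nbhs.
by rewrite /e /=; have [_ ->] := MF_chart (cM s Ss).
Unshelve. all: by end_near. Qed.

End ChartDerivative.

(** * The metric pairing in a frame *)

Section SymplecticForm.
Variable R : realType.
Implicit Types q d : coords R.

(** The polar form of det, with value 2 det V at (V, V). *)
Definition mixed_det (V W : 'M[R]_2) : R :=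
  V 0 0 * W 1 1 + V 1 1 * W 0 0 - V 0 1 * W 1 0 - V 1 0 * W 0 1.

(** Both forms are bilinear, so each contributes the square 1 / J_10 of the
    factor that normalizes e_0, and the square root disappears. *)
Lemma form_inner_frame (J : 'M[R]_2) V V' : complex_structures J ->
  bilinear_form V -> bilinear_form V' ->
  let e := ebasis R 0 in
  form_inner J V V' = (J 1 0 ^+ 2)^-1 * form_inner_at e (J *m e) V V'.
Proof.
move=> cJ [Vr Vl] [Vr' Vl'] e; have [_ _ c0] := complex_structuresE cJ.
have g0 : gJ J e e = J 1 0.
  by rewrite (gJE _ _ cJ) /e !ebasisE /=; ring.
rewrite /form_inner /unit_vector -/e g0 -scalemxAr.
set r := (Num.sqrt _)^-1.
have r2 : r * r = (J 1 0)^-1 by rewrite -invfM -expr2 sqr_sqrtr // ltW.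
have scal (F : 'cV[R]_2 -> 'M[R]_2) a X : linear F -> F (a *: X) = a *: F X.
  move=> lF; have F0 : F 0 = 0.
    by have := lF (-1) 0 0; rewrite scaler0 addr0 scaleN1r addNr.
  by rewrite -[a *: X]addr0 lF F0 addr0.
have V2 X Y : V (r *: X) (r *: Y) = (J 1 0)^-1 *: V X Y.
  by rewrite (scal _ _ _ (Vr _)) (scal (V^~ Y) _ _ (Vl _)) scalerA r2.
have V2' X Y : V' (r *: X) (r *: Y) = (J 1 0)^-1 *: V' X Y.
  by rewrite (scal _ _ _ (Vr' _)) (scal (V'^~ Y) _ _ (Vl' _)) scalerA r2.
rewrite /form_inner_at !V2 !V2' -!scalemxAl -!scalemxAr !mxtraceZ.
rewrite expr2 invfM; ring.
Qed.

Lemma bilinear_trace_part (V : End_form R) :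
  bilinear_form V -> bilinear_form (trace_part V).
Proof.
move=> [Vr Vl]; split=> [X a Y Y'|Y a X X']; rewrite /trace_part.
  by rewrite Vr mxtraceD mxtraceZ mulrDr scalerDl scalerA mulrCA.
by rewrite (Vl Y) mxtraceD mxtraceZ mulrDr scalerDl scalerA mulrCA.
Qed.

Lemma bilinear_comb (V W : End_form R) (A B : 'M[R]_2) :
  bilinear_form V -> bilinear_form W ->
  bilinear_form (fun X Y => V X Y *m A - W X Y *m B).
Proof.
move=> [Vr Vl] [Wr Wl]; split=> [X a Y Y'|Y a X X'].
  by rewrite Vr Wr !mulmxDl -!scalemxAl scalerBr opprD addrACA.
by rewrite (Vl Y) (Wl Y) !mulmxDl -!scalemxAl scalerBr opprD addrACA.
Qed.

Lemma bilinear_traceless_part (V : End_form R) :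
  bilinear_form V -> bilinear_form (traceless_part V).
Proof.
move=> bV; have := bilinear_comb 1%:M 1%:M bV (bilinear_trace_part bV).
by congr bilinear_form; apply/funext => X; apply/funext => Y; rewrite !mulmx1.
Qed.

Lemma mxtrace2 (A : 'M[R]_2) : \tr A = A 0 0 + A 1 1.
Proof. by rewrite /mxtrace sum2. Qed.

(** For matrices of size 2 with traceless parts V_0, W_0 and trace parts V_t, W_t,
    tr (V_0 W_0) - tr (V_t W_t) = tr (V W) - tr V tr W = - [mixed_det V W], so
    no decomposition into trace and traceless parts is needed to evaluate the
    pairing in the metric. *)
Lemma form_inner_diff (J : 'M[R]_2) V V' : complex_structures J ->
  bilinear_form V -> bilinear_form V' ->
  let e := ebasis R 0 in let e' := J *m e in
  form_inner J (traceless_part V) (traceless_part V')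
  - form_inner J (trace_part V) (trace_part V') =
  - (4 * J 1 0 ^+ 2)^-1 *
    (mixed_det (V e e) (V' e e) + mixed_det (V e e') (V' e e')
     + mixed_det (V e' e) (V' e' e) + mixed_det (V e' e') (V' e' e')).
Proof.
move=> cJ bV bV' e e'.
rewrite !form_inner_frame //; try exact: bilinear_trace_part;
  try exact: bilinear_traceless_part.
have D (A B : 'M[R]_2) : \tr ((A - (2^-1 * \tr A) *: 1%:M) *m (B - (2^-1 * \tr B) *: 1%:M))
    - \tr (((2^-1 * \tr A) *: 1%:M) *m ((2^-1 * \tr B) *: (1%:M : 'M[R]_2))) = - mixed_det A B.
  rewrite !mxtrace2 !mulmx2E !mxE /= !mulr1n !mulr0n /mixed_det; by field.
rewrite -mulrBr /form_inner_at -mulrBr.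
rewrite -/e -/e' /traceless_part /trace_part.
pose T (A B : 'M[R]_2) := \tr (((2^-1 * \tr A) *: 1%:M) *m ((2^-1 * \tr B) *: (1%:M : 'M[R]_2))).
have {}D (A B : 'M[R]_2) : \tr ((A - (2^-1 * \tr A) *: 1%:M) *m (B - (2^-1 * \tr B) *: 1%:M))
   = T A B - mixed_det A B by move: (D A B); rewrite -/(T A B); lra.
rewrite !D -!/(T _ _); have [_ _ c0] := complex_structuresE cJ; by field; rewrite gt_eqF.
Qed.

Lemma mxtrace_mul2 (A B : 'M[R]_2) : \tr (A *m B) =
  A 0 0 * B 0 0 + A 0 1 * B 1 0 + (A 1 0 * B 0 1 + A 1 1 * B 1 1).
Proof. by rewrite mxtrace2 !mulmx2E. Qed.

Lemma gram_inv q : 0 < cy q ->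
  invmx (gram (cplx_structure q)) = \matrix_(i, j)
    if i == 0 then (if j == 0 then (cx q ^+ 2 + cy q ^+ 2) / cy q else cx q / cy q)
    else if j == 0 then cx q / cy q else (cy q)^-1.
Proof.
move=> y0; have cJ := cplx_structure_complex y0.
have yn : cy q != 0 by rewrite gt_eqF.
apply: (can_inj (mulKmx (gram_unit cJ))); rewrite mulmxV ?gram_unit //.
apply/matrixP => i j; rewrite mulmx2E !mxE !(gJE _ _ cJ) !ebasisE !mxE.
by case: (ord2P i) => ->; case: (ord2P j) => ->; rewrite /= ?(mulr0n, mulr1n); field.
Qed.

Lemma raise_symmetric q P (X Y : 'cV[R]_2) (i j : 'I_2) : 0 < cy q ->
  let S n := X 0 0 * Y 0 0 * P n + (X 0 0 * Y 1 0 + X 1 0 * Y 0 0) * P n.+1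
             + X 1 0 * Y 1 0 * P n.+2 in
  raise (cplx_structure q) (symmetric_tensor P) X Y i j =
  if i == 0 then ((cx q ^+ 2 + cy q ^+ 2) / cy q) * S (j : nat) + cx q / cy q * S j.+1
  else cx q / cy q * S (j : nat) + (cy q)^-1 * S j.+1.
Proof.
move=> y0 S; have yn : cy q != 0 by rewrite gt_eqF.
rewrite /raise -trmx_inv gram_inv // mulmx2E !mxE !teval_symmetric_tensor !ebasisE /S.
by case: (ord2P i) => ->; case: (ord2P j) => -> /=; field.
Qed.

Definition norm2 q : R := cy q ^+ 4 * (cu q ^+ 2 + cv q ^+ 2).

Lemma half_norm2_chart q : 0 < cy q -> half_norm2 (chart q) = norm2 q.
Proof.
move=> y0; have yn : cy q != 0 by rewrite gt_eqF.
rewrite /half_norm2 form_inner_frame; last exact: raise_bilinear.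
- rewrite /form_inner_at /= !mxtrace_mul2 !raise_symmetric // !mulmx2E !ebasisE !mxE /= /norm2.
  by field.
- exact: cplx_structure_complex.
- exact: raise_bilinear.
Qed.

(** Real part, and then imaginary part, of A = dkappa + 2 i kappa dconj z / y. As
    dw = (i / 2y) dconj z (w - conj w), the first variation of Re (kappa w^4) is
    Re (A w^4) + Re (B w^3 conj w) with B = - 2 i kappa dconj z / y. The trace
    part and the traceless part of the second term have the same norm, so it
    does not contribute to the metric. *)
Definition hor_re q d := cu d + 2 * (cu q * cy d - cv q * cx d) / cy q.
Definition hor_im q d := cv d + 2 * (cu q * cx d + cv q * cy d) / cy q.

End SymplecticForm.

Lemma det_mx2 (K : comRingType) (M : 'M[K]_2) :
  \det M = M 0 0 * M 1 1 - M 0 1 * M 1 0.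
Proof.
rewrite (expand_det_row _ 0) sum2 /cofactor !det_mx11 !mxE.
have -> : lift 0 0 = 1 :> 'I_2 by exact: val_inj.
have -> : lift 1 0 = 0 :> 'I_2 by exact: val_inj.
by rewrite /= expr0 expr1 mul1r mulN1r mulrN.
Qed.

(** * Invariance of the form under SL(2, R) *)

Section SL2Invariance.
Variable R : realType.
Variable A : SL2 R.
Implicit Types (J : 'M[R]_2) (X Y Z W : 'cV[R]_2).
Let B := invmx (SL2_val A).

Lemma SL2_mulV : SL2_val A *m B = 1%:M.
Proof. by rewrite mulmxV ?SL2_unit. Qed.
Lemma SL2_Vmul : B *m SL2_val A = 1%:M.
Proof. by rewrite mulVmx ?SL2_unit. Qed.
Lemma SL2_mulK X : B *m (SL2_val A *m X) = X.
Proof. by rewrite mulmxA SL2_Vmul mul1mx. Qed.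
Lemma SL2_mulVK X : SL2_val A *m (B *m X) = X.
Proof. by rewrite mulmxA SL2_mulV mul1mx. Qed.

Lemma rho0_SL2 X Y : rho0 (SL2_val A *m X) (SL2_val A *m Y) = rho0 X Y.
Proof.
have := eqP (valP A); rewrite det_mx2 /= => d1.
rewrite /rho0 !mulmx2E -[RHS]mul1r -d1; ring.
Qed.

Lemma gJ_SL2 J X Y :
  gJ (SL2_val A *m J *m B) (SL2_val A *m X) (SL2_val A *m Y) = gJ J X Y.
Proof. by rewrite /gJ -!mulmxA SL2_mulK rho0_SL2. Qed.

Lemma complex_structures_SL2 J :
  complex_structures J -> complex_structures (SL2_val A *m J *m B).
Proof.
move=> [JJ [X [X0 rX]]]; split.
  rewrite -!mulmxA (mulmxA B) SL2_Vmul mul1mx (mulmxA J) JJ.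
  by rewrite mulNmx mul1mx mulmxN SL2_mulV.
exists (SL2_val A *m X); split; last by rewrite -!mulmxA SL2_mulK rho0_SL2.
by apply: contra X0 => /eqP e; rewrite -(SL2_mulK X) e mulmx0.
Qed.

Lemma teval_SL2_act p X Y Z W :
  teval (SL2_act A p).2 X Y Z W = teval p.2 (B *m X) (B *m Y) (B *m Z) (B *m W).
Proof.
have [t1 t2 t3 t4] := teval_multilinear p.2.
rewrite /= teval_tensor //; split=> *;
  by rewrite mulmxDr -scalemxAr ?(t1, t2, t3, t4).
Qed.

(** The uniqueness part of the definition of g_J^{-1} T. *)
Lemma gJ_inj J (M N : 'M[R]_2) : complex_structures J ->
  (forall Z W, gJ J (M *m Z) W = gJ J (N *m Z) W) -> M = N.
Proof.
move=> [JJ _] MN.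
have H Z W : rho0 (M *m Z) W = rho0 (N *m Z) W.
  by have := MN Z (J *m - W); rewrite /gJ mulmxA JJ mulNmx mul1mx opprK.
apply/matrixP => i j.
have E (K : 'M[R]_2) : K i j = (K *m ebasis R j) i 0.
  by rewrite mulmx2E !ebasisE; case: (ord2P j) => -> /=; rewrite !(mulr1, mulr0, addr0, add0r).
rewrite !E; have := H (ebasis R j) (ebasis R 0); have := H (ebasis R j) (ebasis R 1).
rewrite /rho0 !ebasisE /= !(mulr1, mulr0, subr0, sub0r) => e0 /oppr_inj e1.
by case: (ord2P i) => ->.
Qed.

Lemma raise_SL2 p X Y : complex_structures p.1 ->
  raise (SL2_val A *m p.1 *m B) (SL2_act A p).2 (SL2_val A *m X) (SL2_val A *m Y)
  = SL2_val A *m raise p.1 p.2 X Y *m B.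
Proof.
move=> cJ; apply: (gJ_inj (complex_structures_SL2 cJ)) => Z W.
rewrite raiseP; last exact: complex_structures_SL2.
rewrite teval_SL2_act !SL2_mulK -(raiseP _ _ _ _ _ cJ) -[in LHS]gJ_SL2.
by rewrite SL2_mulVK -!mulmxA.
Qed.

(** [A] maps a g_J-orthonormal frame to an orthonormal frame for the transported
    structure, and the pairing may be computed in any such frame. *)
Lemma form_inner_SL2 J (V V' W W' : End_form R) : complex_structures J ->
  bilinear_form V -> bilinear_form V' -> bilinear_form W -> bilinear_form W' ->
  (forall X Y, W (SL2_val A *m X) (SL2_val A *m Y) = SL2_val A *m V X Y *m B) ->
  (forall X Y, W' (SL2_val A *m X) (SL2_val A *m Y) = SL2_val A *m V' X Y *m B) ->
  form_inner (SL2_val A *m J *m B) W W' = form_inner J V V'.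
Proof.
move=> cJ bV bV' bW bW' WV WV'; have uu := gJ_unit_vector cJ.
rewrite (@form_innerE _ _ W W' (SL2_val A *m unit_vector J)) ?gJ_SL2 //; last first.
  exact: complex_structures_SL2.
rewrite -!mulmxA SL2_mulK /form_inner /form_inner_at !WV !WV'.
have tr2 (M N : 'M[R]_2) :
    \tr (SL2_val A *m M *m B *m (SL2_val A *m N *m B)) = \tr (M *m N).
  rewrite -!mulmxA (mulmxA B) SL2_Vmul mul1mx mxtrace_mulC -!mulmxA SL2_Vmul.
  by rewrite mulmx1.
by rewrite !tr2.
Qed.

Lemma trace_part_SL2 (V W : End_form R) :
  (forall X Y, W (SL2_val A *m X) (SL2_val A *m Y) = SL2_val A *m V X Y *m B) ->
  forall X Y, trace_part W (SL2_val A *m X) (SL2_val A *m Y) =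
              SL2_val A *m trace_part V X Y *m B.
Proof.
move=> WV X Y; rewrite /trace_part WV mxtrace_mulC mulmxA SL2_Vmul mul1mx.
by rewrite -scalemxAr mulmx1 -scalemxAl SL2_mulV.
Qed.

Lemma traceless_part_SL2 (V W : End_form R) :
  (forall X Y, W (SL2_val A *m X) (SL2_val A *m Y) = SL2_val A *m V X Y *m B) ->
  forall X Y, traceless_part W (SL2_val A *m X) (SL2_val A *m Y) =
              SL2_val A *m traceless_part V X Y *m B.
Proof.
move=> WV X Y; rewrite /traceless_part (trace_part_SL2 WV) WV.
by rewrite mulmxBr mulmxBl.
Qed.

Lemma half_norm2_SL2 p : complex_structures p.1 ->
  half_norm2 (SL2_act A p) = half_norm2 p.
Proof.
move=> cJ; rewrite /half_norm2; congr (_ / _).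
apply: form_inner_SL2 => //; try exact: raise_bilinear;
  by move=> X Y; exact: raise_SL2.
Qed.

Lemma bilinear_cplx_I p (v : ambient R) :
  bilinear_form (cplx_I p (tangent_rep p v)).2.
Proof.
have := bilinear_comb (- p.1) v.1 (raise_bilinear p.1 v.2) (raise_bilinear p.1 p.2).
by congr bilinear_form; apply/funext => X; apply/funext => Y; rewrite mulmxN.
Qed.

(** Every ingredient of the form is natural under linear maps that preserve rho0.
    Besides being a part of the symplecticity of the action, this allows one to
    assume x = 0 in the computation of the form. *)
Lemma omega_SL2 f p v w : complex_structures p.1 ->
  omega_f f (SL2_act A p) (SL2_act A v) (SL2_act A w) = omega_f f p v w.
Proof.
move=> cJ; rewrite /omega_f /g_f half_norm2_SL2 //.
have rv X Y : (tangent_rep (SL2_act A p) (SL2_act A v)).2 (SL2_val A *m X) (SL2_val A *m Y)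
    = SL2_val A *m (tangent_rep p v).2 X Y *m B.
  exact: (@raise_SL2 (p.1, v.2)).
have rI X Y : (cplx_I (SL2_act A p) (tangent_rep (SL2_act A p) (SL2_act A w))).2
      (SL2_val A *m X) (SL2_val A *m Y)
    = SL2_val A *m (cplx_I p (tangent_rep p w)).2 X Y *m B.
  have e1 := @raise_SL2 (p.1, w.2) X Y cJ; have e2 := raise_SL2 X Y cJ.
  rewrite [LHS]/= [X in _ *m X *m _]/= mulmxBr mulmxBl mulmxN mulNmx.
  congr (- _ - _).
    by rewrite e1 -!mulmxA (mulmxA B) SL2_Vmul mul1mx.
  by rewrite e2 -!mulmxA (mulmxA B) SL2_Vmul mul1mx.
have bv p' v' : bilinear_form (tangent_rep p' v' : tvec R).2 by exact: raise_bilinear.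
congr (_ * _ + _ * (_ - _)).
- rewrite /J_inner /=; congr (_ * _).
  rewrite mulmxN !mulmxA -(mulmxA _ B) SL2_Vmul mulmx1.
  rewrite -(mulmxA _ B) SL2_Vmul mulmx1.
  by rewrite mulmxN !raddfN /= -!mulmxA (mxtrace_mulC (SL2_val A)) -!mulmxA SL2_Vmul mulmx1.
- apply: form_inner_SL2 => //; try exact: traceless_part_SL2;
    apply: bilinear_traceless_part; by [exact: bv|exact: bilinear_cplx_I].
- apply: form_inner_SL2 => //; try exact: trace_part_SL2;
    apply: bilinear_trace_part; by [exact: bv|exact: bilinear_cplx_I].
Qed.

End SL2Invariance.

(** * The form in the chart *)

Section OmegaChart.
Variable R : realType.
Implicit Types q d : coords R.

Lemma SL2_inv (A : SL2 R) : invmx (SL2_val A) = \matrix_(i, j)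
  if i == 0 then (if j == 0 then SL2_val A 1 1 else - SL2_val A 0 1)
  else if j == 0 then - SL2_val A 1 0 else SL2_val A 0 0.
Proof.
apply: (can_inj (mulKmx (SL2_unit A))); rewrite mulmxV ?SL2_unit //.
have /eqP := valP A; rewrite det_mx2 /= => dA.
apply/matrixP => i j; rewrite mulmx2E !mxE.
by case: (ord2P i) => ->; case: (ord2P j) => -> /=; rewrite ?mulr1n ?mulr0n -?dA; ring.
Qed.

Lemma translation_subproof (x : R) :
  \det (\matrix_(i < 2, j < 2) (if i == j then 1 else if i == 0 then x else 0)) == 1.
Proof. by rewrite det_mx2 !mxE /= mulr0 subr0 mulr1. Qed.
Definition translation (x : R) : SL2 R := MkSL2 (translation_subproof x).

Lemma mulmx3E (A J B : 'M[R]_2) i j : (A *m J *m B) i j =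
  (A i 0 * J 0 0 + A i 1 * J 1 0) * B 0 j + (A i 0 * J 0 1 + A i 1 * J 1 1) * B 1 j.
Proof. by rewrite !mulmx2E. Qed.

Lemma SL2_act_symmetric (A : SL2 R) J P i j k l :
  let B := invmx (SL2_val A) in
  (SL2_act A (J, symmetric_tensor P)).2 (mxvec_index i j) (mxvec_index k l) =
  teval (symmetric_tensor P) (col i B) (col j B) (col k B) (col l B).
Proof.
move=> B; rewrite /= tensorE /=.
have E m : B *m ebasis R m = col m B by rewrite /ebasis colE.
by rewrite !E.
Qed.

Lemma translate_chart q : cy q != 0 ->
  SL2_act (translation (cx q)) (chart (Coords 0 (cy q) (cu q) (cv q))) = chart q.
Proof.
move=> y0; rewrite /SL2_act /chart; congr (_, _).
  apply/matrixP => i j; rewrite mulmx3E SL2_inv !mxE.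
  by case: (ord2P i) => ->; case: (ord2P j) => -> /=; field.
apply: mx22P => i j k l; rewrite symmetric_tensorE.
rewrite [LHS](SL2_act_symmetric _ (1%:M)) SL2_inv teval_symmetric_tensor !mxE.
by case: (ord2P i) => ->; case: (ord2P j) => ->; case: (ord2P k) => ->;
  case: (ord2P l) => -> /=; ring.
Qed.

Lemma translate_d_chart q d : cy q != 0 ->
  SL2_act (translation (cx q)) (d_chart (Coords 0 (cy q) (cu q) (cv q)) d)
  = d_chart q d.
Proof.
move=> y0; rewrite /SL2_act /d_chart; congr (_, _).
  apply/matrixP => i j; rewrite mulmx3E SL2_inv !mxE.
  by case: (ord2P i) => ->; case: (ord2P j) => -> /=; field.
apply: mx22P => i j k l; rewrite symmetric_tensorE.
rewrite [LHS](SL2_act_symmetric _ (1%:M)) SL2_inv teval_symmetric_tensor !mxE.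
by case: (ord2P i) => ->; case: (ord2P j) => ->; case: (ord2P k) => ->;
  case: (ord2P l) => -> /=; ring.
Qed.

(** When x = 0 the frame e_0, J e_0 is parallel to the standard basis and the Gram
    matrix is diag (1/y, y): on a pair of vectors of the frame, g_J^{-1} T is
    up to a power of y the Hankel matrix of the components of T with its rows
    multiplied by y and 1/y. *)
Definition raised_hankel (y : R) (P : nat -> R) (n : nat) : 'M[R]_2 :=
  \matrix_(i, j) if i == 0 then (if j == 0 then y * P n else y * P n.+1)
    else if j == 0 then P n.+1 / y else P n.+2 / y.

Lemma raise_vertical q P : 0 < cy q -> cx q = 0 ->
  let J := cplx_structure q in let e := ebasis R 0 in
  [/\ raise J (symmetric_tensor P) e e = raised_hankel (cy q) P 0,
      raise J (symmetric_tensor P) e (J *m e) = (cy q)^-1 *: raised_hankel (cy q) P 1,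
      raise J (symmetric_tensor P) (J *m e) e = (cy q)^-1 *: raised_hankel (cy q) P 1 &
      raise J (symmetric_tensor P) (J *m e) (J *m e) = (cy q)^-2 *: raised_hankel (cy q) P 2].
Proof.
move=> y0 x0 J e; have yn : cy q != 0 by rewrite gt_eqF.
have J1 : J *m ebasis R 0 = (cy q)^-1 *: ebasis R 1.
  apply/matrixP => i j; rewrite (ord1 j) mulmx2E !mxE /= x0.
  by case: (ord2P i) => -> /=; rewrite ?mul0r ?mulr0 ?mulr1 ?addr0.
split; apply/matrixP => i j; rewrite raise_symmetric // ?J1 /e !mxE x0 /=;
  by case: (ord2P i) => ->; case: (ord2P j) => -> /=; field.
Qed.

Lemma omega_chart0 f q d d' : 0 < cy q -> cx q = 0 ->
  let t := norm2 q in
  omega_f f (chart q) (d_chart q d) (d_chart q d') =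
    - (1 - f t) / cy q ^+ 2 * (cx d * cy d' - cy d * cx d')
    + half_line_derive f t * cy q ^+ 4 *
      (hor_re q d * hor_im q d' - hor_im q d * hor_re q d').
Proof.
move=> y0 x0 t; have yn : cy q != 0 by rewrite gt_eqF.
have cJ := cplx_structure_complex y0.
rewrite /omega_f /g_f half_norm2_chart // -/t.
have -> : J_inner (tangent_rep (chart q) (d_chart q d)).1
    (cplx_I (chart q) (tangent_rep (chart q) (d_chart q d'))).1 =
    - (cx d * cy d' - cy d * cx d') / cy q ^+ 2.
  rewrite /J_inner /= mxtrace_mul2 !mxE !sum2 !mxE /= x0; by field.
rewrite (form_inner_diff cJ (raise_bilinear _ _) (bilinear_cplx_I _ _)) /=.
have [-> -> -> ->] := raise_vertical (fun n => (quartic_coef q n).1) y0 x0.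
have [-> -> -> ->] := raise_vertical (fun n => (d_quartic_coef q d n).1) y0 x0.
have [-> -> -> ->] := raise_vertical (fun n => (d_quartic_coef q d' n).1) y0 x0.
have sub2 (A B C D : 'M[R]_2) i j : (- (A *m B) - C *m D) i j =
    - (A i 0 * B 0 j + A i 1 * B 1 j) - (C i 0 * D 0 j + C i 1 * D 1 j).
  by rewrite !mxE !sum2.
rewrite /mixed_det !sub2 !mxE /= x0 /hor_re /hor_im.
set F := f t; set F' := half_line_derive f t; clearbody F F'; clear t sub2 cJ.
case: q y0 x0 yn => x y u v /= y0 x0 yn; case: d => a b c e; case: d' => a' b' c' e' /=.
rewrite !(oppr0, mul0r, mulr0, add0r, addr0, sub0r, subr0).
by field.
Qed.

(** A translation of z moves the point to x = 0 and leaves y, kappa and the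
    components of tangent vectors unchanged. *)
Lemma omega_chart f q d d' : 0 < cy q ->
  let t := norm2 q in
  omega_f f (chart q) (d_chart q d) (d_chart q d') =
    - (1 - f t) / cy q ^+ 2 * (cx d * cy d' - cy d * cx d')
    + half_line_derive f t * cy q ^+ 4 *
      (hor_re q d * hor_im q d' - hor_im q d * hor_re q d').
Proof.
move=> y0 t; have yn : cy q != 0 by rewrite gt_eqF.
rewrite -(translate_chart yn) -!(translate_d_chart _ yn) omega_SL2; last first.
  exact: cplx_structure_complex.
by rewrite omega_chart0.
Qed.

End OmegaChart.

(** * A smooth decreasing function on the half-line and its inverse *)

Section HalfLine.
Variables (R : realType) (f : R -> R).
Hypothesis f_smooth : smooth_half_line f.
Hypothesis f'_lt0 : forall t : R, 0 <= t -> half_line_derive f t < 0.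

Definition half_line_derive_iter (k : nat) := iter k (@half_line_derive R) f.

(** At t > 0 the constraint 0 <= t + h holds for all small h, so that the
    one-sided derivative is a derivative. *)
Lemma is_derive_half_line k (t : R) : 0 < t ->
  is_derive t 1 (half_line_derive_iter k) (half_line_derive_iter k.+1 t).
Proof.
move=> t0; have cv := @f_smooth k t (ltW t0).
set g := half_line_derive_iter k.
have wE : within [set h | 0 <= t + h] (0 : R)^' = (0 : R)^'.
  rewrite eqEsubset; split=> S; last exact: cvg_within.
  move=> wS; have n0 : \forall h \near (0 : R)^', 0 <= t + h.
    apply: nbhs_dnbhs; near=> h; apply/ltW; rewrite -ltrBlDl sub0r.
    by near: h; apply: lt_nbhsr; rewrite oppr_lt0.
  by apply: (filterS _ (filterI n0 wS)) => h' [h0 H]; exact: H.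
have E : (fun h => h^-1 *: (g (h *: (1 : R) + t) - g t)) =
         (fun h => h^-1 * (g (t + h) - g t)).
  by apply/funext => h; rewrite /GRing.scale /= mulr1 [t + h]addrC.
split.
  by rewrite /derivable E -wE; exact: cv.
by rewrite /derive E -wE.
Unshelve. all: by end_near. Qed.

Let df (t : R) : 0 < t -> is_derive t 1 f (half_line_derive f t).
Proof. exact: (@is_derive_half_line 0). Qed.

Lemma half_line_inj (s t : R) : 0 < s -> 0 < t -> f s = f t -> s = t.
Proof.
wlog st : s t / s < t.
  move=> W s0 t0 e; have [l|l|//] := ltgtP s t; first exact: W.
  by apply/esym; apply: W.
move=> s0 t0 fst.
have pos x : x \in `[s, t] -> 0 < x by rewrite in_itv => /andP[sx _]; exact: lt_le_trans sx.
have d x : x \in `]s, t[ -> is_derive x 1 f (half_line_derive f x).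
  by move=> xst; apply: df; apply: pos; exact: subset_itv_oo_cc.
have c : {within `[s, t], continuous f}.
  apply: continuous_in_subspaceT => x /set_mem xst.
  by apply: differentiable_continuous; apply/derivable1_diffP; have [] := df (pos x xst).
have [x xst] := MVT st d c.
rewrite fst subrr => /esym/eqP; rewrite mulf_eq0 => /orP[|].
  by rewrite lt_eqF // f'_lt0 // ltW // pos //; exact: subset_itv_oo_cc.
by rewrite subr_eq0 => /eqP.
Qed.

Definition half_line_range : set R := [set h | exists2 t, 0 < t & f t = h].
Definition half_line_inv (h : R) : R := xget 0 [set t | 0 < t /\ f t = h].

Lemma half_line_invK (t : R) : 0 < t -> half_line_inv (f t) = t.
Proof.
move=> t0; rewrite /half_line_inv; case: xgetP => [s _ [s0]|/(_ t) []] //.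
exact: half_line_inj.
Qed.

Lemma half_line_inv_gt0 h : half_line_range h -> 0 < half_line_inv h.
Proof. by move=> [t t0 <-]; rewrite half_line_invK. Qed.

Lemma half_line_invKV h : half_line_range h -> f (half_line_inv h) = h.
Proof. by move=> [t t0 <-]; rewrite half_line_invK. Qed.

Lemma half_line_continuous (t : R) : 0 < t -> {near t, continuous f}.
Proof.
move=> t0; near=> s; have s0 : 0 < s by near: s; exact: lt_nbhsr.
by apply: differentiable_continuous; apply/derivable1_diffP; have [] := df s0.
Unshelve. all: by end_near. Qed.

Lemma near_half_line_invK (t : R) : 0 < t -> {near t, cancel f half_line_inv}.
Proof.
move=> t0; near=> s; apply: half_line_invK; near: s; exact: lt_nbhsr.
Unshelve. all: by end_near. Qed.

Lemma is_derive_half_line_inv h : half_line_range h ->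
  is_derive h 1 half_line_inv (half_line_derive f (half_line_inv h))^-1.
Proof.
move=> [t t0 <-]; rewrite half_line_invK //; apply: is_derive_inverse.
- exact: near_half_line_invK.
- exact: half_line_continuous.
- exact: df.
- by rewrite lt_eqF // f'_lt0 // ltW.
Qed.

Lemma open_half_line_range : open half_line_range.
Proof.
rewrite openE => h [t t0 <-].
have [ci ck] := near_can_continuousAcan_sym (near_half_line_invK t0) (half_line_continuous t0).
have i0 : \forall h \near f t, 0 < half_line_inv h.
  have c0 : half_line_inv h @[h --> f t] --> half_line_inv (f t) := nbhs_singleton ci.
  by rewrite half_line_invK // in c0; exact: (cvgr_gt _ c0 _ t0).
by apply: filterS (filterI i0 ck) => k [k0 kk]; exists (half_line_inv k).
Qed.

End HalfLine.

(** * Smoothness of the coordinates near MF *)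

Section CoordinateFunctions.
Variable R : realType.

(** An open neighbourhood of MF on which the coordinates, given by rational
    expressions of the ambient components, are smooth. *)
Definition coord_dom : set (ambient R) := [set p | chart_dom (chart_inv p)].

Lemma Ck_ambientJ k (O : set (ambient R)) i j :
  open O -> Ck k O (fun p : ambient R => p.1 i j).
Proof. by move=> oO; apply: Ck_coord => //; apply: Ck_fst => //; exact: Ck_id. Qed.

Lemma Ck_ambientT k (O : set (ambient R)) i j :
  open O -> Ck k O (fun p : ambient R => p.2 i j).
Proof. by move=> oO; apply: Ck_coord => //; apply: Ck_snd => //; exact: Ck_id. Qed.

Lemma Ck_cu k (O : set (ambient R)) : open O -> Ck k O (fun p => cu (chart_inv p)).
Proof. by move=> oO; exact: Ck_ambientT. Qed.

Lemma Ck_cv k (O : set (ambient R)) : open O -> Ck k O (fun p => cv (chart_inv p)).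
Proof.
move=> oO; apply: CkN => //; apply: CkD => //; apply: CkM => //;
  by [exact: Ck_ambientT|exact: Ck_ambientJ].
Qed.

Lemma Ck_kappa2 k (O : set (ambient R)) : open O ->
  Ck k O (fun p => cu (chart_inv p) ^+ 2 + cv (chart_inv p) ^+ 2).
Proof.
by move=> oO; apply: CkD => //; apply: CkX => //; [exact: Ck_cu|exact: Ck_cv].
Qed.

Lemma coord_domE : coord_dom = [set p : ambient R | 0 < p.1 1 0] `&`
   [set p : ambient R | 0 < cu (chart_inv p) ^+ 2 + cv (chart_inv p) ^+ 2].
Proof.
apply/seteqP; split=> p; rewrite /coord_dom /chart_dom /= invr_gt0;
  by case.
Qed.

Lemma open_coord_dom : open coord_dom.
Proof.
rewrite coord_domE; apply: openI.
  apply: (@open_comp _ _ (fun p : ambient R => p.1 1 0) [set x | 0 < x]).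
    by move=> p _; apply: (@Ck_ambientJ 0 setT) => //; exact: openT.
  exact: open_gt.
apply: (@open_comp _ _ (fun p : ambient R => cu (chart_inv p) ^+ 2 + cv (chart_inv p) ^+ 2) [set x | 0 < x]).
  by move=> p _; apply: (@Ck_kappa2 0 setT) => //; exact: openT.
exact: open_gt.
Qed.

Lemma MF_coord_dom : @MF R `<=` coord_dom.
Proof. by move=> p /MF_chart[]. Qed.

Let oO := open_coord_dom.

Lemma coord_dom_J10 p : coord_dom p -> p.1 1 0 != 0.
Proof. by rewrite coord_domE => -[/= h _]; rewrite gt_eqF. Qed.

Lemma Ck_cy k : Ck k coord_dom (fun p => cy (chart_inv p)).
Proof. by apply: CkV; [|exact: coord_dom_J10|exact: Ck_ambientJ]. Qed.

Lemma Ck_cx k : Ck k coord_dom (fun p => cx (chart_inv p)).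
Proof. by apply: CkM => //; [exact: Ck_ambientJ|exact: Ck_cy]. Qed.

Lemma Ck_norm2 k : Ck k coord_dom (fun p => norm2 (chart_inv p)).
Proof.
by apply: CkM => //; [apply: CkX => //; exact: Ck_cy|exact: Ck_kappa2].
Qed.

Lemma norm2_gt0 (q : coords R) : chart_dom q -> 0 < norm2 q.
Proof. by move=> [y0 k0]; rewrite mulr_gt0 // exprn_gt0. Qed.

Lemma Ck_f_norm2 k (f : R -> R) : smooth_half_line f ->
  Ck k coord_dom (fun p => f (norm2 (chart_inv p))).
Proof.
move=> sf; apply: (@Ck_tower _ _ _ oO k 0 (half_line_derive_iter f)).
  move=> m p Op; apply: is_derive_half_line => //; exact: norm2_gt0.
exact: Ck_norm2.
Qed.

End CoordinateFunctions.

(** * The Darboux coordinates *)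

Section DarbouxCoordinates.
Variables (R : realType) (f : R -> R).
Hypothesis f_smooth : smooth_half_line f.
Hypothesis f_le0 : forall t : R, 0 <= t -> f t <= 0.
Hypothesis f'_lt0 : forall t : R, 0 <= t -> half_line_derive f t < 0.

Let oO := @open_coord_dom R.

Definition kappa_norm (q : coords R) : R := Num.sqrt (cu q ^+ 2 + cv q ^+ 2).

(** The angle is - arg kappa since t in R/2piZ acts by kappa |-> e^(-it) kappa;
    this sign makes F / 2, rather than - F / 2, its conjugate variable. The
    default value of [insubd] is never taken on [coord_dom]. *)
Definition minus_arg (p : ambient R) : circle R :=
  let q := chart_inv p in
  insubd (circle1 R) ((cu q / kappa_norm q) +i* (- (cv q / kappa_norm q)))%C.

(** With F = f(t), these are F / 2 and (1 - F) / y. *)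
Definition action1 (p : ambient R) : R := f (norm2 (chart_inv p)) / 2.
Definition action2 (p : ambient R) : R := (1 - f (norm2 (chart_inv p))) * p.1 1 0.

Lemma kappa_norm_gt0 q : chart_dom q -> 0 < kappa_norm q.
Proof. by move=> [_ k0]; rewrite sqrtr_gt0. Qed.

Lemma minus_argE p : coord_dom p ->
  val (minus_arg p) = ((cu (chart_inv p) / kappa_norm (chart_inv p))
     +i* (- (cv (chart_inv p) / kappa_norm (chart_inv p))))%C.
Proof.
move=> dp; have k0 := kappa_norm_gt0 dp; apply: insubdK.
rewrite /in_mem /= normc_def /= sqrrN !expr_div_n -mulrDl sqr_sqrtr; last first.
  by have [_ /ltW] := dp.
by rewrite divff ?sqrtr1 // gt_eqF //; have [] := dp.
Qed.

Lemma angle_reE p : coord_dom p ->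
  angle_re minus_arg p = cu (chart_inv p) / kappa_norm (chart_inv p).
Proof. by move=> dp; rewrite /angle_re minus_argE. Qed.

Lemma angle_imE p : coord_dom p ->
  angle_im minus_arg p = - (cv (chart_inv p) / kappa_norm (chart_inv p)).
Proof. by move=> dp; rewrite /angle_im minus_argE. Qed.

Lemma Ck_kappa_normV k : Ck k (@coord_dom R) (fun p => (kappa_norm (chart_inv p))^-1).
Proof.
apply: CkV => //; first by move=> p dp; rewrite gt_eqF //; exact: kappa_norm_gt0.
by apply: Ck_sqrt => //; [move=> p []|exact: Ck_kappa2].
Qed.

Lemma Ck_angle_re k : Ck k (@coord_dom R) (angle_re minus_arg).
Proof.
apply: (Ck_ext oO) (CkM oO (Ck_cu k oO) (Ck_kappa_normV k)) => p dp.
by rewrite angle_reE.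
Qed.

Lemma Ck_angle_im k : Ck k (@coord_dom R) (angle_im minus_arg).
Proof.
apply: (Ck_ext oO) (CkN oO (CkM oO (Ck_cv k oO) (Ck_kappa_normV k))) => p dp.
by rewrite angle_imE.
Qed.

Lemma Ck_action1 k : Ck k (@coord_dom R) action1.
Proof.
apply: (Ck_ext oO) (Ck_scale oO 2^-1 (Ck_f_norm2 k f_smooth)) => p dp.
by rewrite mulrC.
Qed.

Lemma Ck_1f k : Ck k (@coord_dom R) (fun p => 1 - f (norm2 (chart_inv p))).
Proof.
by apply: CkD => //; [exact: Ck_cst|apply: CkN => //; exact: Ck_f_norm2].
Qed.

Lemma Ck_action2 k : Ck k (@coord_dom R) action2.
Proof. by apply: CkM => //; [exact: Ck_1f|exact: Ck_ambientJ]. Qed.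

Lemma Ck_chart (V : normedModType R) (O : set V) k (c : V -> coords R) :
  open O -> (forall x, O x -> cy (c x) != 0) ->
  Ck k O (fun x => cx (c x)) -> Ck k O (fun x => cy (c x)) ->
  Ck k O (fun x => cu (c x)) -> Ck k O (fun x => cv (c x)) ->
  Ck k O (fun x => chart (c x)).
Proof.
move=> oV y0 kx ky ku kv; have kV := CkV oV y0 ky.
apply: Ck_pair => //; apply: Ck_mx => //.
  move=> i j; have [m m0] : exists m : V -> R, Ck k O m /\
      forall x, m x = cplx_structure (c x) i j.
    case: (ord2P i) => ->; case: (ord2P j) => ->; eexists; split=> [|x];
      rewrite ?mxE //=.
    - exact: (CkM oV kx kV).
    - exact: (CkN oV (CkM oV (CkD oV (CkX oV 2 kx) (CkX oV 2 ky)) kV)).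
    - exact: kV.
    - exact: (CkN oV (CkM oV kx kV)).
  by have [Cm mE] := m0; apply: (Ck_ext oV) Cm => x _.
move=> a b; case/mxvec_indexP: a => i j; case/mxvec_indexP: b => l m.
have [H _] : Ck k O (fun x => (quartic_coef (c x) (i + j + l + m)).1) /\
    Ck k O (fun x => (quartic_coef (c x) (i + j + l + m)).2).
  elim: (i + j + l + m)%N => [|n [IH1 IH2]] //; split=> /=.
    exact: (CkD oV (CkM oV (CkN oV kx) IH1) (CkN oV (CkM oV ky IH2))).
  exact: (CkD oV (CkM oV ky IH1) (CkN oV (CkM oV kx IH2))).
by apply: (Ck_ext oV) H => x _; rewrite symmetric_tensorE.
Qed.

Definition action_range : set (R * R) :=
  [set h | half_line_range f (2 * h.1) /\ 0 < h.2].

(** With h = (h_1, h_2) the values of the actions, f(t) = 2 h_1 gives t, then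
    (1 - f(t)) / y = h_2 gives y, and finally |kappa| = sqrt t / y^2. *)
Definition darboux_coords (h : (R * R) * R * (R * R)) : coords R :=
  let t := half_line_inv f (2 * h.2.1) in
  let y := (1 - 2 * h.2.1) / h.2.2 in
  let r := Num.sqrt t / y ^+ 2 in
  Coords h.1.2 y (r * h.1.1.1) (- (r * h.1.1.2)).

Lemma action_range_y (h : R * R) : action_range h -> 0 < (1 - 2 * h.1) / h.2.
Proof.
move=> [[t t0 e] h2]; rewrite divr_gt0 // subr_gt0 -e.
by rewrite (le_lt_trans (f_le0 (ltW t0))) // ltr01.
Qed.

Lemma open_action_range : open action_range.
Proof.
have -> : action_range = (fun h : R * R => 2 * h.1) @^-1` half_line_range f `&`
    (fun h : R * R => h.2) @^-1` [set x | 0 < x] by [].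
have C2 : Ck 0 setT (fun h : R * R => 2 * h.1).
  by apply: Ck_scale; [exact: openT|apply: Ck_fst; [exact: openT|apply: Ck_id; exact: openT]].
apply: openI; apply: open_comp.
- by move=> h _; exact: C2.
- exact: open_half_line_range.
- by move=> h _; exact: cvg_snd.
- exact: open_gt.
Qed.

Lemma darboux_coords_spec h : h.1.1.1 ^+ 2 + h.1.1.2 ^+ 2 = 1 -> action_range h.2 ->
  let q := darboux_coords h in
  [/\ chart_dom q, norm2 q = half_line_inv f (2 * h.2.1) &
      kappa_norm q = Num.sqrt (half_line_inv f (2 * h.2.1)) / cy q ^+ 2].
Proof.
move=> c1 Oh q; have y0 : 0 < cy q by exact: action_range_y.
have t0 : 0 < half_line_inv f (2 * h.2.1) by case: Oh => rh _; exact: half_line_inv_gt0.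
set t := half_line_inv _ _ in t0 *; pose r := Num.sqrt t / cy q ^+ 2.
have r0 : 0 < r by rewrite divr_gt0 ?sqrtr_gt0 ?exprn_gt0.
have k2 : cu q ^+ 2 + cv q ^+ 2 = r ^+ 2.
  rewrite -[RHS]mulr1 -c1 /= -/t -/(cy q) -/r; ring.
split; first by split=> //; rewrite k2 exprn_gt0.
- have r2 : r ^+ 2 = t / cy q ^+ 4 by rewrite /r expr_div_n sqr_sqrtr ?ltW // -exprM.
  by rewrite /norm2 k2 r2 mulrC mulfVK // expf_neq0 // gt_eqF.
- by rewrite /kappa_norm k2 sqrtr_sqr gtr0_norm.
Qed.

Lemma darboux_diffeomorphism :
  diffeomorphism (@MF R)
    [set x : (R * R) * R * (R * R) | x.1.1.1 ^+ 2 + x.1.1.2 ^+ 2 = 1 /\ action_range x.2]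
    (fun p => (angle_re minus_arg p, angle_im minus_arg p, cx (chart_inv p),
               (action1 p, action2 p))).
Proof.
split.
- exists (@coord_dom R); split=> //; first exact: MF_coord_dom.
  move=> k; apply: Ck_pair => //; last first.
    by apply: Ck_pair => //; [exact: Ck_action1|exact: Ck_action2].
  apply: Ck_pair => //; last exact: Ck_cx.
  by apply: Ck_pair => //; [exact: Ck_angle_re|exact: Ck_angle_im].
- move=> p Mp; have dp := MF_coord_dom Mp; have k0 := kappa_norm_gt0 dp.
  have t0 := norm2_gt0 dp.
  split=> /=.
    rewrite angle_reE // angle_imE // sqrrN !expr_div_n -mulrDl sqr_sqrtr.
      by rewrite divff // gt_eqF //; have [] := dp.
    by have [_ /ltW] := dp.
  split=> /=; first by exists (norm2 (chart_inv p)) => //; rewrite /action1 mulrC divfK.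
  rewrite mulr_gt0 ?subr_gt0 ?(le_lt_trans (f_le0 (ltW t0))) ?ltr01 //.
  by move: dp; rewrite coord_domE => -[].
pose O := [set h : (R * R) * R * (R * R) | action_range h.2].
have oV : open O.
  apply: open_comp; last exact: open_action_range.
  by move=> h _; exact: cvg_snd.
have yO h : O h -> cy (darboux_coords h) != 0.
  by move=> Oh; rewrite gt_eqF //; exact: action_range_y.
exists (fun h => chart (darboux_coords h)); split.
- exists O; split=> //; first by move=> h [].
  move=> k.
  have kid : Ck k O id := Ck_id oV k.
  have k1 := Ck_fst oV (Ck_snd oV kid); have k2 := Ck_snd oV (Ck_snd oV kid).
  have k2h := Ck_scale oV 2 k1.
  have ky : Ck k O (fun h => cy (darboux_coords h)).
    apply: CkM => //; first by apply: CkD => //; [exact: Ck_cst|exact: CkN].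
    by apply: CkV => // h [_ h2]; rewrite gt_eqF.
  have kt : Ck k O (fun h => half_line_inv f (2 * h.2.1)).
    apply: (@Ck_inverse _ _ _ oV k (half_line_derive_iter f) (half_line_inv f) _ _ _ _ k2h).
    + by move=> h [rh _]; exact: is_derive_half_line_inv.
    + move=> h [rh _]; rewrite lt_eqF // f'_lt0 // ltW //.
      exact: half_line_inv_gt0.
    + move=> m h [rh _]; apply: is_derive_half_line => //.
      exact: half_line_inv_gt0.
  have kr : Ck k O (fun h => Num.sqrt (half_line_inv f (2 * h.2.1)) *
                             (cy (darboux_coords h) ^+ 2)^-1).
    apply: CkM => //.
      by apply: Ck_sqrt => // h [rh _]; exact: half_line_inv_gt0.
    apply: CkV => //; last exact: CkX.
    by move=> h Oh; rewrite expf_neq0 // yO.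
  apply: Ck_chart => //=.
  + exact: (Ck_snd oV (Ck_fst oV kid)).
  + exact: (CkM oV kr (Ck_fst oV (Ck_fst oV (Ck_fst oV kid)))).
  + exact: (CkN oV (CkM oV kr (Ck_snd oV (Ck_fst oV (Ck_fst oV kid))))).
- by move=> h [c1 Oh]; apply: chart_MF; have [] := darboux_coords_spec c1 Oh.
- move=> p Mp; have dp := MF_coord_dom Mp.
  have [_ pE] := MF_chart Mp; rewrite -[RHS]pE; congr chart.
  have k0 := kappa_norm_gt0 dp; have t0 := norm2_gt0 dp.
  have J0 := coord_dom_J10 dp; have [y0 kp] := dp.
  rewrite /darboux_coords /= angle_reE // angle_imE // /action1 /action2.
  rewrite [2 * _]mulrC divfK // half_line_invK //.
  have f1 : 1 - f (norm2 (chart_inv p)) != 0.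
    by rewrite gt_eqF // subr_gt0 (le_lt_trans (f_le0 (ltW t0))) // ltr01.
  have -> : (1 - f (norm2 (chart_inv p))) /
      ((1 - f (norm2 (chart_inv p))) * p.1 1 0) = cy (chart_inv p).
    by rewrite invfM mulrA divff // mul1r.
  have -> : Num.sqrt (norm2 (chart_inv p)) / cy (chart_inv p) ^+ 2
      = kappa_norm (chart_inv p).
    rewrite /norm2 sqrtrM ?exprn_ge0 ?ltW // -[4%N]/(2 * 2)%N exprM sqrtr_sqr.
    by rewrite ger0_norm ?exprn_ge0 ?ltW // mulrAC divff ?mul1r // expf_neq0 // gt_eqF.
  have kn : kappa_norm (chart_inv p) != 0 by rewrite gt_eqF.
  rewrite -[p.1 0 0 / p.1 1 0]/(cx (chart_inv p)).
  move: (kappa_norm _) kn => k kn; case: (chart_inv p) => x y u v /=.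
  have kk a : k * (a / k) = a by rewrite mulrC divfK.
  by rewrite mulrN opprK !kk.
- move=> h [c1 Oh]; have [dq t2 k2] := darboux_coords_spec c1 Oh.
  have y0 : cy (darboux_coords h) != 0 by exact: yO.
  have Mq : coord_dom (chart (darboux_coords h)).
    by apply: MF_coord_dom; exact: chart_MF.
  have r0 := kappa_norm_gt0 dq; have [rh h2] := Oh.
  rewrite angle_reE // angle_imE // /action1 /action2 chartK // k2 t2.
  rewrite half_line_invKV // mxE /=.
  case: h Oh dq t2 k2 y0 Mq r0 rh h2 c1 => [[[c s] x] [h1 h2]] /= Oh dq t2 k2 y0 Mq r0 rh h20 c1.
  rewrite k2 /= in r0; set r := _ / _ in r0 *.
  have rn : r != 0 by rewrite gt_eqF.
  congr (_, _, _, (_, _)).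
  + by rewrite mulrAC divff ?mul1r.
  + by rewrite mulNr opprK mulrAC divff ?mul1r.
  + by rewrite mulrAC divff ?mul1r.
  + rewrite invf_div mulrCA divff ?mulr1 //.
    by move: y0; rewrite mulf_eq0 negb_or => /andP[].
Qed.

Lemma chart_dom_near (q d : coords R) : chart_dom q ->
  \forall s \near (0 : R), chart_dom (affine_coords q d s).
Proof.
move=> [y0 k0].
have dy : is_derive (0 : R) 1 (fun s => cy (affine_coords q d s)) (cy d) by exact: is_derive_affine.
have dk : derivable (fun s : R => cu (affine_coords q d s) ^+ 2 + cv (affine_coords q d s) ^+ 2) 0 1.
  have du := is_derive_affine (cu q) (cu d) 0; have dv := is_derive_affine (cv q) (cv d) 0.
  by have [] := is_derive_add (is_derive_mul du du) (is_derive_mul dv dv).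
have cy0 : {for (0 : R), continuous (fun s => cy (affine_coords q d s))}.
  by apply: differentiable_continuous; apply/derivable1_diffP; have [] := dy.
have ck0 := differentiable_continuous ((derivable1_diffP _ _).1 dk).
have n1 : \forall s \near (0 : R), 0 < cy (affine_coords q d s).
  by apply: (cvgr_gt _ cy0); rewrite affine_coords0.
have n2 : \forall s \near (0 : R),
    0 < cu (affine_coords q d s) ^+ 2 + cv (affine_coords q d s) ^+ 2.
  by apply: (cvgr_gt _ ck0); rewrite affine_coords0.
by apply: filterS (filterI n1 n2).
Qed.

Lemma derive_coord (F : ambient R -> R) (g : coords R -> R) q d l : chart_dom q ->
  Ck 1 (@coord_dom R) F -> (forall q', chart_dom q' -> F (chart q') = g q') ->
  is_derive (0 : R) 1 (fun s => g (affine_coords q d s)) l ->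
  'D_(d_chart q d) F (chart q) = l.
Proof.
move=> dq cF Fg gl; have [y0 _] := dq.
apply: derive_chart; first by rewrite gt_eqF.
  by apply: Ck_diff cF _; apply: MF_coord_dom; exact: chart_MF.
apply: near_eq_is_derive gl; near=> s.
by rewrite Fg //; near: s; exact: chart_dom_near.
Unshelve. all: by end_near. Qed.

Lemma chart_domK (q : coords R) : chart_dom q -> chart_inv (chart q) = q.
Proof. by move=> [y0 _]; rewrite chartK // gt_eqF. Qed.

Definition d_norm2 (q d : coords R) : R :=
  4 * cy q ^+ 3 * cy d * (cu q ^+ 2 + cv q ^+ 2)
  + 2 * cy q ^+ 4 * (cu q * cu d + cv q * cv d).

Lemma is_derive_norm2 q d :
  is_derive (0 : R) 1 (fun s => norm2 (affine_coords q d s)) (d_norm2 q d).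
Proof.
have dy := is_derive_affine (cy q) (cy d) 0.
have du := is_derive_affine (cu q) (cu d) 0.
have dv := is_derive_affine (cv q) (cv d) 0.
have H := is_derive_mul (is_derive_mul (is_derive_mul dy dy) (is_derive_mul dy dy))
  (is_derive_add (is_derive_mul du du) (is_derive_mul dv dv)).
apply: (near_eq_is_derive _ (is_derive_eq H _)).
  by near=> s; rewrite /norm2 /= -[4%N]/(2 * 2)%N exprM !expr2.
by rewrite /d_norm2 !mul0r !addr0; ring.
Unshelve. all: by end_near. Qed.

Lemma is_derive_f_norm2 q d : chart_dom q ->
  is_derive (0 : R) 1 (fun s => f (norm2 (affine_coords q d s)))
    (half_line_derive f (norm2 q) * d_norm2 q d).
Proof.
move=> dq; apply: is_derive_chain; first exact: is_derive_norm2.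
rewrite affine_coords0; apply: (@is_derive_half_line _ _ f_smooth 0).
exact: norm2_gt0.
Qed.

Lemma derive_action1 q d : chart_dom q ->
  'D_(d_chart q d) action1 (chart q) = half_line_derive f (norm2 q) * d_norm2 q d / 2.
Proof.
move=> dq; apply: (derive_coord (g := fun q => f (norm2 q) / 2)) => //.
- exact: Ck_action1.
- by move=> q' dq'; rewrite /action1 chart_domK.
have H := is_derive_mul (is_derive_f_norm2 d dq) (is_derive_const 2^-1 0).
by apply: (is_derive_eq H); rewrite mulr0 addr0.
Qed.

Lemma derive_1f_mul q d (g : ambient R -> R) (h : coords R -> R) l : chart_dom q ->
  Ck 1 (@coord_dom R) g -> (forall q', chart_dom q' -> g (chart q') = h q') ->
  is_derive (0 : R) 1 (fun s => h (affine_coords q d s)) l ->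
  'D_(d_chart q d) (fun p => (1 - f (norm2 (chart_inv p))) * g p) (chart q) =
  - (half_line_derive f (norm2 q) * d_norm2 q d) * h q + (1 - f (norm2 q)) * l.
Proof.
move=> dq cg gh hl.
have cF := CkM oO (Ck_1f 1) cg.
have E q' : chart_dom q' -> ((fun p => 1 - f (norm2 (chart_inv p))) \* g) (chart q') =
    (1 - f (norm2 q')) * h q'.
  by move=> dq'; rewrite -(gh q' dq') -{2}(chart_domK dq').
have H := is_derive_mul (is_derive_add (is_derive_const 1 0) (is_derive_opp (is_derive_f_norm2 d dq))) hl.
rewrite [LHS](derive_coord (g := fun q => (1 - f (norm2 q)) * h q) dq cF E H).
by rewrite add0r affine_coords0.
Qed.

Lemma chart_J10 (q : coords R) : (chart q).1 1 0 = (cy q)^-1.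
Proof. by rewrite mxE. Qed.

Lemma derive_action2 q d : chart_dom q ->
  'D_(d_chart q d) action2 (chart q) =
  - (half_line_derive f (norm2 q) * d_norm2 q d) / cy q
  - (1 - f (norm2 q)) * cy d / cy q ^+ 2.
Proof.
move=> dq; have [y0 _] := dq.
have H : is_derive (0 : R) 1 (fun s => (cy (affine_coords q d s))^-1) (- cy d / cy q ^+ 2).
  have H := is_derive_inv (is_derive_affine (cy q) (cy d) 0).
  by apply: (is_derive_eq (H _)); rewrite mul0r addr0 // gt_eqF.
have cJ : Ck 1 (@coord_dom R) (fun p : ambient R => p.1 1 0) by exact: Ck_ambientJ.
rewrite [LHS](derive_1f_mul (h := fun q => (cy q)^-1) dq cJ (fun q' _ => chart_J10 q') H).
by rewrite !mulNr mulrN mulrA.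
Qed.

Lemma derive_cx q d : chart_dom q ->
  'D_(d_chart q d) (fun p : ambient R => cx (chart_inv p)) (chart q) = cx d.
Proof.
move=> dq; apply: (derive_coord (g := fun q => cx q)) => //; [exact: Ck_cx|by move=> ? ?; rewrite chart_domK|].
exact: is_derive_affine.
Qed.

(** The factor 1 / |kappa| is common to c = cos theta and s = sin theta, so its
    derivative cancels in c ds - s dc. *)
Lemma derive_minus_arg q d : chart_dom q ->
  dangle minus_arg (chart q) (d_chart q d) =
  - (cu q * cv d - cv q * cu d) / (cu q ^+ 2 + cv q ^+ 2).
Proof.
move=> dq; have [y0 k0] := dq; have yn : cy q != 0 by rewrite gt_eqF.
have Oq : coord_dom (chart q) by apply: MF_coord_dom; exact: chart_MF.
have dcu : 'D_(d_chart q d) (fun p : ambient R => cu (chart_inv p)) (chart q) = cu d.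
  apply: (derive_coord (g := fun q => cu q)) => //; [exact: Ck_cu|by move=> ? ?; rewrite chart_domK|].
  exact: is_derive_affine.
have dcv : 'D_(d_chart q d) (fun p : ambient R => cv (chart_inv p)) (chart q) = cv d.
  apply: (derive_coord (g := fun q => cv q)) => //; [exact: Ck_cv|by move=> ? ?; rewrite chart_domK|].
  exact: is_derive_affine.
pose K (p : ambient R) := (kappa_norm (chart_inv p))^-1.
have cK := Ck_kappa_normV 1.
have near_dom : \forall p \near chart q, coord_dom p by exact: open_nbhs_nbhs.
have derU : derivable (fun p : ambient R => cu (chart_inv p)) (chart q) (d_chart q d).
  by apply: diff_derivable; exact: (Ck_diff (Ck_cu 1 oO)).
have derV : derivable (fun p : ambient R => cv (chart_inv p)) (chart q) (d_chart q d).
  by apply: diff_derivable; exact: (Ck_diff (Ck_cv 1 oO)).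
have derK : derivable K (chart q) (d_chart q d).
  by apply: diff_derivable; exact: (Ck_diff cK).
have dre : 'D_(d_chart q d) (angle_re minus_arg) (chart q) =
    cu q * 'D_(d_chart q d) K (chart q) + K (chart q) * cu d.
  rewrite (near_eq_derive (g := (fun p : ambient R => cu (chart_inv p)) \* K)); last first.
    by near=> p; rewrite angle_reE //; near: p.
  rewrite (deriveM derU derK) dcu.
  by rewrite -[LHS]/(cu (chart_inv (chart q)) * _ + K (chart q) * cu d) chartK.
have dim : 'D_(d_chart q d) (angle_im minus_arg) (chart q) =
    - (cv q * 'D_(d_chart q d) K (chart q) + K (chart q) * cv d).
  rewrite (near_eq_derive (g := - ((fun p : ambient R => cv (chart_inv p)) \* K))); last first.
    by near=> p; rewrite angle_imE //; near: p.
  rewrite (deriveN (derivableM derV derK)) (deriveM derV derK) dcv.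
  by rewrite -[LHS]/(- (cv (chart_inv (chart q)) * _ + K (chart q) * cv d)) chartK.
rewrite /dangle dre dim angle_reE // angle_imE // chartK //.
have K2 : K (chart q) ^+ 2 = (cu q ^+ 2 + cv q ^+ 2)^-1.
  by rewrite /K chartK // exprVn sqr_sqrtr // ltW.
rewrite -K2; have -> : K (chart q) = (kappa_norm q)^-1 by rewrite /K chartK.
move: (kappa_norm q) => k; ring.
Unshelve. all: by end_near. Qed.

(** In polar coordinates kappa = y^{-2} r e^(i phi) the form reads
    d ((F - 1) / y) /\ dx + d (F / 2) /\ dphi. The identity is checked on
    tangent vectors, both sides being explicit in the chart. *)
Lemma darboux_form p v w : MF p -> tangent (@MF R) p v -> tangent (@MF R) p w ->
  omega_f f p v w =
    (dangle minus_arg p v * 'D_w action1 p - dangle minus_arg p w * 'D_v action1 p)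
  + ('D_v (fun p : ambient R => cx (chart_inv p)) p * 'D_w action2 p
     - 'D_w (fun p : ambient R => cx (chart_inv p)) p * 'D_v action2 p).
Proof.
move=> Mp; have [dq <-] := MF_chart Mp; move: (chart_inv p) dq => q dq.
move=> /(tangent_chart dq)[d ->] /(tangent_chart dq)[d' ->].
have [y0 k0] := dq; have yn : cy q != 0 by rewrite gt_eqF.
rewrite !derive_minus_arg // !derive_action1 // !derive_action2 // !derive_cx //.
rewrite omega_chart // /hor_re /hor_im /d_norm2.
have : cu q ^+ 2 + cv q ^+ 2 != 0 by rewrite gt_eqF.
move: (f _) (half_line_derive _ _) => F F' kn; by field; rewrite yn kn.
Qed.

End DarbouxCoordinates.

(** * The action of the circle *)

Section CircleAction.
Variables (R : realType) (f : R -> R).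
Hypothesis f_smooth : smooth_half_line f.
Implicit Types (z : circle R) (q d : coords R).

Let oO := @open_coord_dom R.

Lemma circle_ReIm z : complex.Re (val z) ^+ 2 + complex.Im (val z) ^+ 2 = 1.
Proof.
have /eqP := valP z; case: (val z) => a b; rewrite normc_def /= => -[e].
have s0 : 0 <= a ^+ 2 + b ^+ 2 by rewrite addr_ge0 ?sqr_ge0.
by rewrite -(sqr_sqrtr s0) e expr1n.
Qed.

Lemma circle_invE z :
  (val z)^-1 = (complex.Re (val z) -i* complex.Im (val z))%C.
Proof.
have := circle_ReIm z; have := circle_neq0 z; case: (val z) => a b /= z0 ab.
apply: (mulfI z0); rewrite mulfV //; apply/eqP; rewrite eq_complex /=.
by rewrite -ab; apply/andP; split; apply/eqP; ring.
Qed.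

Lemma S1_act2E z (p : ambient R) i j k l :
  (S1_act z p).2 (mxvec_index i j) (mxvec_index k l) =
  complex.Re (val z) * p.2 (mxvec_index i j) (mxvec_index k l)
  - complex.Im (val z) * (p.2 (mxvec_index i j) (mxvec_index k 0) * p.1 0 l
                        + p.2 (mxvec_index i j) (mxvec_index k 1) * p.1 1 l).
Proof.
rewrite /= tensorE -[circle_val z]/(val z) circle_invE /quartic_differential.
rewrite teval_ebasis /=.
have -> : p.1 *m ebasis R l = p.1 0 l *: ebasis R 0 + p.1 1 l *: ebasis R 1.
  rewrite [LHS]col2E !mulmx2E !ebasisE.
  by case: (ord2P l) => -> /=; rewrite !(mulr1, mulr0, addr0, add0r).
have [_ _ _ t4] := teval_multilinear p.2.
rewrite t4 -[p.1 1 l *: _]addr0 t4 !teval_ebasis.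
have -> : teval p.2 (ebasis R i) (ebasis R j) (ebasis R k) 0 = 0.
  by rewrite /teval !sum2 !mxE; ring.
ring.
Qed.

(** The action of z on kappa is multiplication by conj z = z^{-1}. *)
Definition rotate z q : coords R :=
  let c := complex.Re (val z) in let s := complex.Im (val z) in
  Coords (cx q) (cy q) (c * cu q + s * cv q) (c * cv q - s * cu q).

Lemma quartic_coef_rotate z q n :
  quartic_coef (rotate z q) n =
  let c := complex.Re (val z) in let s := complex.Im (val z) in
  (c * (quartic_coef q n).1 + s * (quartic_coef q n).2,
   c * (quartic_coef q n).2 - s * (quartic_coef q n).1).
Proof. by elim: n => [//|n IH]; rewrite /= IH /=; congr (_, _); ring. Qed.

Lemma S1_act_chart z q : cy q != 0 -> S1_act z (chart q) = chart (rotate z q).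
Proof.
move=> y0; rewrite [LHS]surjective_pairing; congr (_, _).
apply: mx22P => i j k l; rewrite S1_act2E /= !symmetric_tensorE !mxE.
rewrite quartic_coef_rotate /=.
case: (ord2P l) => -> /=; rewrite ?addn0 ?addn1 /=; by field.
Qed.

Lemma rotate1 q : rotate (1%g : circle R) q = q.
Proof.
case: q => x y u v; rewrite /rotate -[val _]/(1 : R[i]) /=.
by congr Coords; ring.
Qed.

Lemma rotateM z w q : rotate (z * w)%g q = rotate z (rotate w q).
Proof.
rewrite /rotate -[val (z * w)%g]/(val z * val w).
by case: (val z) (val w) => [a b] [c e] /=; congr Coords; ring.
Qed.

Lemma rotate_affine z q d s :
  rotate z (affine_coords q d s) = affine_coords (rotate z q) (rotate z d) s.
Proof. by rewrite /rotate /affine_coords /=; congr Coords; ring. Qed.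

Lemma kappa2_rotate z q :
  cu (rotate z q) ^+ 2 + cv (rotate z q) ^+ 2 = cu q ^+ 2 + cv q ^+ 2.
Proof. by rewrite /= -[RHS]mul1r -(circle_ReIm z); ring. Qed.

Lemma chart_dom_rotate z q : chart_dom q -> chart_dom (rotate z q).
Proof. by case=> y0 k0; split=> //; rewrite kappa2_rotate. Qed.

Lemma norm2_rotate z q : norm2 (rotate z q) = norm2 q.
Proof. by rewrite /norm2 kappa2_rotate. Qed.

Lemma Ck_S1_act k z : Ck k setT (S1_act z : ambient R -> ambient R).
Proof.
have oT : open [set: ambient R] by exact: openT.
apply: Ck_pair => //; first by apply: Ck_fst => //; exact: Ck_id.
apply: Ck_mx => // a b; case/mxvec_indexP: a => i j; case/mxvec_indexP: b => m l.
apply: (Ck_ext oT (F := fun p : ambient R =>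
  complex.Re (val z) * p.2 (mxvec_index i j) (mxvec_index m l)
  - complex.Im (val z) * (p.2 (mxvec_index i j) (mxvec_index m 0) * p.1 0 l
                        + p.2 (mxvec_index i j) (mxvec_index m 1) * p.1 1 l))).
  by move=> p _; rewrite -S1_act2E.
apply: CkD => //; first by apply: Ck_scale => //; exact: Ck_ambientT.
apply: CkN => //; apply: Ck_scale => //; apply: CkD => //; apply: CkM => //;
  by [exact: Ck_ambientT|exact: Ck_ambientJ].
Qed.

Lemma derive_S1_act z q d : chart_dom q ->
  'D_(d_chart q d) (S1_act z) (chart q) = d_chart (rotate z q) (rotate z d).
Proof.
move=> dq; have [y0 _] := dq; have yn : cy q != 0 by rewrite gt_eqF.
apply: derive_chart => //; first exact: Ck_diff (Ck_S1_act 1 z) I.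
apply: near_eq_is_derive (is_derive_chart_line (rotate z d) _) => //.
near=> s; rewrite S1_act_chart ?rotate_affine //.
have [ys _] : chart_dom (affine_coords q d s) by near: s; exact: chart_dom_near.
by rewrite gt_eqF.
Unshelve. all: by end_near. Qed.

(** A is multiplied by the unit complex number z^{-1}, which preserves
    Re A /\ Im A. *)
Lemma omega_rotate z q d d' : chart_dom q ->
  omega_f f (chart (rotate z q)) (d_chart (rotate z q) (rotate z d))
    (d_chart (rotate z q) (rotate z d')) =
  omega_f f (chart q) (d_chart q d) (d_chart q d').
Proof.
move=> [y0 _]; have yn : cy q != 0 by rewrite gt_eqF.
rewrite !omega_chart // norm2_rotate; congr (_ + _ * _).
have hr e : hor_re (rotate z q) (rotate z e) =
    complex.Re (val z) * hor_re q e + complex.Im (val z) * hor_im q e.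
  by rewrite /hor_re /hor_im /=; ring.
have hi e : hor_im (rotate z q) (rotate z e) =
    complex.Re (val z) * hor_im q e - complex.Im (val z) * hor_re q e.
  by rewrite /hor_re /hor_im /=; ring.
by rewrite !hr !hi -[RHS]mul1r -(circle_ReIm z); ring.
Qed.

Lemma S1_symplectic : symplectic_action (@MF R) (omega_f f) (@S1_act R).
Proof.
split.
- move=> z; split; first by exists setT; split=> // [|k]; [exact: openT|exact: Ck_S1_act].
  move=> p Mp; have [dq pE] := MF_chart Mp; have [y0 _] := dq.
  rewrite -pE S1_act_chart ?gt_eqF //.
  by apply: chart_MF; exact: chart_dom_rotate.
- move=> p Mp; have [dq pE] := MF_chart Mp; have [y0 _] := dq.
  by rewrite -pE S1_act_chart ?gt_eqF // rotate1.
- move=> z w p Mp; have [dq pE] := MF_chart Mp; have [y0 _] := dq.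
  by rewrite -pE !S1_act_chart ?gt_eqF // rotateM.
- move=> z p v w Mp; have [dq <-] := MF_chart Mp.
  move: (chart_inv p) dq => q dq.
  move=> /(tangent_chart dq)[d ->] /(tangent_chart dq)[d' ->].
  have [y0 _] := dq.
  have e1 := derive_S1_act z d dq; have e2 := derive_S1_act z d' dq.
  have e3 : S1_act z (chart q) = chart (rotate z q) by rewrite S1_act_chart ?gt_eqF.
  rewrite e1 e2 e3; exact: omega_rotate.
Qed.

Lemma S1_moment_linear (p : ambient R) :
  linear_for *%R (fun xi : R^o => (xi : R) * action1 f p).
Proof. by move=> a x y; rewrite mulrDl -mulrA. Qed.

Definition S1_moment (p : ambient R) : {scalar (lie_algebra (S1 R))} :=
  HB.pack (fun xi : R^o => (xi : R) * action1 f p)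
    (GRing.isLinear.Build _ _ _ _ _ (S1_moment_linear p)).

(** The field generated by xi is - xi d/dphi, and its contraction with
    d (F / 2) /\ dphi is xi d (F / 2). *)
Lemma S1_moment_map : moment_map (@MF R) (omega_f f) (@S1_act R) S1_moment.
Proof.
split.
- move=> xi; exists (@coord_dom R); split=> //; first exact: MF_coord_dom.
  by move=> k; apply: Ck_scale => //; exact: Ck_action1.
- move=> z p xi Mp; have [dq pE] := MF_chart Mp; have [y0 _] := dq.
  rewrite -pE S1_act_chart ?gt_eqF //= /action1 !chartK ?gt_eqF //.
  by rewrite norm2_rotate.
- move=> xi p Mp; have [dq <-] := MF_chart Mp; move: (chart_inv p) dq => q dq.
  have [y0 k0] := dq; have yn : cy q != 0 by rewrite gt_eqF.
  pose d := Coords 0 0 ((xi : R) * cv q) (- ((xi : R) * cu q)).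
  pose c (t : R) := rotate (circle_exp (t *: xi)) q.
  have cE : action_orbit (@S1_act R) xi (chart q) = fun t => chart (c t).
    by apply/funext => t; rewrite /action_orbit S1_act_chart.
  have c0 : c 0 = q.
    rewrite /c /rotate /= scale0r cos0 sin0; case: (q) => x y u v /=.
    by congr Coords; ring.
  have dc : is_derive_coords c 0 d.
    have xid : is_derive (0 : R) 1 (fun t : R => t *: xi : R) xi.
      by apply: is_derive_eq; rewrite /GRing.scale /=; ring.
    have dcos : is_derive (0 : R) 1 (fun t : R => cos (t *: xi : R)) 0.
      apply: (is_derive_eq (is_derive_chain xid (is_derive_cos _))).
      by rewrite scale0r sin0 oppr0 mul0r.
    have dsin : is_derive (0 : R) 1 (fun t : R => sin (t *: xi : R)) xi.
      apply: (is_derive_eq (is_derive_chain xid (is_derive_sin _))).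
      by rewrite scale0r cos0 mul1r.
    have K := is_derive_const _ (0 : R).
    split=> /=.
    + exact: is_derive_const.
    + exact: is_derive_const.
    + have H := is_derive_add (is_derive_mul dcos (K (cu q))) (is_derive_mul dsin (K (cv q))).
      by apply: (is_derive_eq H); ring.
    + have H := is_derive_add (is_derive_mul dcos (K (cv q)))
        (is_derive_opp (is_derive_mul dsin (K (cu q)))).
      by apply: (is_derive_eq H); ring.
  have dO : is_derive (0 : R) 1 (action_orbit (@S1_act R) xi (chart q)) (d_chart q d).
    by rewrite cE -[q in d_chart q d]c0; apply: is_derive_chart; rewrite ?c0.
  have [dO1 dO2] := dO.
  split=> // v /(tangent_chart dq)[d' ->].
  rewrite /fundamental_field derive1E dO2 omega_chart //.
  have -> : 'D_(d_chart q d') (fun p => S1_moment p xi : R) (chart q) =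
      (xi : R) * (half_line_derive f (norm2 q) * d_norm2 q d' / 2).
    rewrite -(derive_action1 f_smooth d' dq).
    apply: deriveZ; apply: diff_derivable.
    apply: (Ck_diff (Ck_action1 f_smooth 1)).
    by apply: MF_coord_dom; exact: chart_MF.
  by rewrite /hor_re /hor_im /d_norm2 /=; field.
Qed.

End CircleAction.

(** * The action of PSL(2, R) *)

Section SL2Action.
Variable R : realType.
Implicit Types (A : SL2 R) (g h : PSL2 R) (p : ambient R).

Let oT : open [set: ambient R] := openT.

Lemma SL2_act2E A p i j k l :
  let B := invmx (SL2_val A) in
  (SL2_act A p).2 (mxvec_index i j) (mxvec_index k l) =
  teval p.2 (col i B) (col j B) (col k B) (col l B).
Proof. by move=> B; rewrite -teval_ebasis teval_SL2_act /ebasis !colE. Qed.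

Lemma SL2_act_linear A : linear (SL2_act A : ambient R -> ambient R).
Proof.
move=> a p q; congr (_, _).
  by rewrite /= mulmxDr mulmxDl -scalemxAr -scalemxAl.
apply: mx22P => i j k l; rewrite [LHS]SL2_act2E /= [RHS]mxE [in RHS]mxE.
rewrite -![tensor _]/((SL2_act A _).2) !SL2_act2E /teval !sum2 !mxE.
ring.
Qed.

Lemma Ck_SL2_act k A : Ck k setT (SL2_act A : ambient R -> ambient R).
Proof.
apply: Ck_pair => //; apply: Ck_mx => //.
  move=> i j.
  apply: (Ck_ext oT (F := fun p : ambient R => _)); first by move=> p _; rewrite mulmx3E; reflexivity.
  by repeat first [apply: CkD => //|apply: CkM => //|exact: Ck_cst|exact: Ck_ambientJ].
move=> a b; case/mxvec_indexP: a => i j; case/mxvec_indexP: b => m l.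
apply: (Ck_ext oT (F := fun p : ambient R => _)).
  by move=> p _; rewrite -[tensor _]/((SL2_act A p).2) SL2_act2E /teval; reflexivity.
do 4 (apply: Ck_sum => // ?); do 4 (apply: CkM => //; last exact: Ck_cst).
exact: Ck_ambientT.
Qed.

Lemma derive_SL2_act A p v : 'D_v (SL2_act A : ambient R -> ambient R) p = SL2_act A v.
Proof.
pose M := GRing.isLinear.Build _ _ _ _ _ (SL2_act_linear A).
pose L : {linear ambient R -> ambient R} := HB.pack (SL2_act A : ambient R -> ambient R) M.
apply: (@derive_linear _ _ _ L) => x; exact: (Ck_SL2_act 0 A x I).
Qed.

Lemma SL2_act_MF A p : MF p -> MF (SL2_act A p).
Proof.
move=> [[cJ sT JT] T0]; split; first split.
- exact: complex_structures_SL2.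
- by move=> X Y Z W; rewrite !teval_SL2_act; exact: sT.
- move=> X Y Z W; rewrite !teval_SL2_act -JT /= -!mulmxA.
  by rewrite !(mulmxA (invmx _) (SL2_val A)) SL2_Vmul !mul1mx.
- apply: contra T0 => /eqP e; apply/eqP; apply: mx22P => i j k l.
  rewrite -teval_ebasis -[ebasis R i](SL2_mulK A) -[ebasis R j](SL2_mulK A).
  rewrite -[ebasis R k](SL2_mulK A) -[ebasis R l](SL2_mulK A) -teval_SL2_act e.
  by rewrite /teval !sum2 !mxE; ring.
Qed.

Lemma SL2_act1 p : SL2_act (SL2_1 R) p = p.
Proof.
rewrite [RHS]surjective_pairing; congr (_, _).
  by rewrite /= invmx1 mul1mx mulmx1.
apply: mx22P => i j k l.
rewrite -[tensor _]/((SL2_act (SL2_1 R) p).2) -teval_ebasis teval_SL2_act /= invmx1 !mul1mx.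
by rewrite teval_ebasis.
Qed.

Lemma SL2_actM A C p : SL2_act (SL2_M A C) p = SL2_act A (SL2_act C p).
Proof.
have iM : invmx (SL2_val A *m SL2_val C) = invmx (SL2_val C) *m invmx (SL2_val A).
  apply: (can_inj (mulKmx (SL2_unit (SL2_M A C)))); rewrite mulmxV; last first.
    exact: (SL2_unit (SL2_M A C)).
  rewrite /= -!mulmxA (mulmxA (SL2_val C)) SL2_mulV mul1mx.
  by rewrite SL2_mulV.
rewrite [LHS]surjective_pairing [RHS]surjective_pairing.
congr (_, _); first by rewrite /= iM !mulmxA.
apply: mx22P => i j k l; rewrite -[LHS]teval_ebasis -[RHS]teval_ebasis.
by rewrite !teval_SL2_act /= iM !mulmxA.
Qed.

Variable f : R -> R.
Hypothesis f_smooth : smooth_half_line f.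

Lemma PSL2_symplectic : symplectic_action (@MF R) (omega_f f) (@PSL2_act R).
Proof.
split.
- move=> g; split; last by move=> p; exact: SL2_act_MF.
  by exists setT; split=> // k; exact: Ck_SL2_act.
- by move=> p _; rewrite -[1%g]/(PSL2_1 R) PSL2_act_pi SL2_act1.
- move=> g h p _; rewrite -[(g * h)%g]/(PSL2_M g h) PSL2_act_pi.
  by rewrite SL2_actM.
- move=> g p v w Mp _ _.
  have e1 := derive_SL2_act (repr g) p v; have e2 := derive_SL2_act (repr g) p w.
  rewrite e1 e2; apply: omega_SL2.
  by case: Mp => -[].
Qed.

Lemma PSL2_moment_linear p : linear_for *%R
  (fun xi : sl2 R => (1 - f (norm2 (chart_inv p))) * \tr (sl2_val xi *m p.1)).
Proof.
move=> a x y /=; rewrite mulmxDl -scalemxAl mxtraceD mxtraceZ mulrDr.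
by rewrite mulrCA.
Qed.

Definition PSL2_moment p : {scalar (lie_algebra (PSL2R R))} :=
  HB.pack (fun xi : sl2 R => (1 - f (norm2 (chart_inv p))) * \tr (sl2_val xi *m p.1))
    (GRing.isLinear.Build _ _ _ _ _ (PSL2_moment_linear p)).

Lemma norm2_SL2 A p : MF p ->
  norm2 (chart_inv (SL2_act A p)) = norm2 (chart_inv p).
Proof.
move=> Mp; have [[y0 _] pE] := MF_chart Mp.
have [[y0' _] pE'] := MF_chart (SL2_act_MF A Mp).
rewrite -(half_norm2_chart y0) -(half_norm2_chart y0') pE pE'; apply: half_norm2_SL2.
by case: Mp => -[].
Qed.

(** The chosen representatives of g and of g^{-1} are inverse to each other only
    up to sign, and the sign cancels in the conjugation. *)
Lemma PSL2_moment_equivariant g p xi : MF p ->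
  PSL2_moment (PSL2_act g p) xi = PSL2_moment p (PSL2_Ad g^-1%g xi).
Proof.
move=> Mp; rewrite /= norm2_SL2 //; congr (_ * _).
rewrite -[(g^-1)%g]/(PSL2_V g).
set A := SL2_val (repr g); set C := SL2_val (repr (PSL2_V g)).
have Ad : C *m sl2_val xi *m invmx C = invmx A *m sl2_val xi *m A.
  case: (PSL2_repr_pi (SL2_V (repr g))) => e; rewrite /C {}e /=.
    by rewrite invmxK.
  have -> : invmx (- invmx A) = - A; last by rewrite mulNmx mulNmx mulmxN opprK.
  have uA : - invmx A \in unitmx.
    by rewrite -scaleN1r unitmxE detZ sqrrN expr1n mul1r -unitmxE unitmx_inv SL2_unit.
  apply: (can_inj (mulKmx uA)); rewrite mulmxV // mulNmx mulmxN opprK.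
  by rewrite mulVmx // SL2_unit.
rewrite Ad.
by rewrite mulmxA (mulmxA (sl2_val xi)) [LHS]mxtrace_mulC !mulmxA.
Qed.

End SL2Action.

(** * The exponential of a traceless matrix *)

Section Exponential.
Variable R : realType.
Implicit Types (M P Q : 'M[R]_2).

(** When the powers of M stay in the span of P and Q, the exponential series is
    a pair of scalar series. *)
Lemma expmx_comb M P Q (a b : nat -> R) (l m : R) :
  (forall k, (k`!%:R)^-1 *: M ^+ k = a k *: P + b k *: Q) ->
  series a @ \oo --> l -> series b @ \oo --> m ->
  expmx M = l *: P + m *: Q.
Proof.
move=> MPQ al bm; rewrite /expmx.
have -> : series (fun k => (k`!%:R)^-1 *: M ^+ k) =
    (fun n => series a n *: P + series b n *: Q).
  apply/funext => n; rewrite /series /= !scaler_suml -big_split /=.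
  by apply: eq_bigr => k _.
by apply: cvg_lim => //; apply: cvgD; exact: cvgZr_tmp.
Qed.

(** The Cayley-Hamilton theorem. *)
Lemma traceless_sqr M : \tr M = 0 -> M *m M = - \det M *: 1%:M.
Proof.
rewrite mxtrace2 => /eqP; rewrite addrC addr_eq0 => /eqP d.
apply/matrixP => i j; rewrite mulmx2E det_mx2 !mxE.
by case: (ord2P i) => ->; case: (ord2P j) => -> /=; rewrite d ?mulr1n ?mulr0n; ring.
Qed.

(** Since M^2 is the scalar - det M, exp (t M) is c(t) + s(t) M where c and s are
    hyperbolic functions, trigonometric functions, or 1 and t, according to the
    sign of det M; its determinant c^2 + s^2 det M is 1. *)
Lemma expmx_traceless M : \tr M = 0 -> exists c s : R -> R,
  [/\ c 0 = 1 /\ s 0 = 0, is_derive (0 : R) 1 c 0, is_derive (0 : R) 1 s 1,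
      forall t, c t ^+ 2 + \det M * s t ^+ 2 = 1 &
      forall t, expmx (t *: M) = c t *: 1%:M + s t *: M].
Proof.
move=> tM; have MM := traceless_sqr tM.
have id1 (w : R) : is_derive (0 : R) 1 (fun t => w * t) w.
  by apply: is_derive_eq; rewrite /GRing.scale /=; ring.
have K (w : R) := is_derive_const w (0 : R).
have [d0|d0|d0] := ltgtP (\det M) 0.
-
  (* M has the eigenvalues w and - w, and P, Q are the spectral projections. *)
  pose w := Num.sqrt (- \det M).
  have w0 : w != 0 by rewrite gt_eqF // sqrtr_gt0 oppr_gt0.
  have w2 : w ^+ 2 = - \det M by rewrite sqr_sqrtr // oppr_ge0 ltW.
  pose P := 2^-1 *: (1%:M + w^-1 *: M); pose Q := 2^-1 *: (1%:M - w^-1 *: M).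
  have MP : M *m P = w *: P.
    have e : M *m (1%:M + w^-1 *: M) = w *: (1%:M + w^-1 *: M).
      rewrite mulmxDr mulmx1 -scalemxAr MM -w2 scalerA expr2 mulKf //.
      by rewrite scalerDr scalerA divff // scale1r addrC.
    by rewrite /P -scalemxAr e !scalerA mulrC.
  have MQ : M *m Q = - w *: Q.
    have e : M *m (1%:M - w^-1 *: M) = - w *: (1%:M - w^-1 *: M).
      rewrite mulmxBr mulmx1 -scalemxAr MM -w2 scalerA expr2 mulKf //.
      by rewrite scalerBr !scaleNr scalerA divff // scale1r opprK addrC.
    by rewrite /Q -scalemxAr e !scalerA mulrC.
  have Mk k : M ^+ k = w ^+ k *: P + (- w) ^+ k *: Q.
    elim: k => [|k IH].
      rewrite !expr0 !scale1r /P /Q -scalerDr addrACA subrr addr0.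
      have h : 2^-1 + 2^-1 = 1 :> R by field.
      by rewrite scalerDr -scalerDl h scale1r.
    rewrite exprS IH -[M * _]/(M *m _) mulmxDr -(scalemxAr _ M P) -(scalemxAr _ M Q) MP MQ.
    rewrite (scalerA _ w P) (scalerA _ (- w) Q).
    by rewrite -!exprSr.
  exists (fun t => (expR (w * t) + expR (- w * t)) * 2^-1).
  exists (fun t => (expR (w * t) + - expR (- w * t)) * (2 * w)^-1).
  have dE v : is_derive (0 : R) 1 (fun t => expR (v * t)) v.
    apply: (is_derive_eq (is_derive_chain (id1 v) (is_derive_expR _))).
    by rewrite mulr0 expR0 mul1r.
  split.
  + by rewrite !mulr0 expR0 subrr mul0r; split=> //; field.
  + apply: (is_derive_eq (is_derive_mul (is_derive_add (dE w) (dE (- w))) (K _))).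
    by rewrite !mulr0 subrr mul0r addr0.
  + apply: (is_derive_eq (is_derive_mul (is_derive_add (dE w) (is_derive_opp (dE (- w)))) (K _))).
    by rewrite mulr0 addr0; field.
  + move=> t; have -> : \det M = - w ^+ 2 by rewrite w2 opprK.
    have : expR (w * t) * expR (- w * t) = 1 by rewrite -expRD mulNr subrr expR0.
    move: (expR _) (expR _) => x y xy; transitivity (y * x) => //; by field.
  + move=> t; rewrite (@expmx_comb _ P Q (exp_coeff (w * t)) (exp_coeff (- w * t))
      (expR (w * t)) (expR (- w * t))).
    * rewrite /P /Q !scalerA !scalerDr !scalerN !scalerA addrACA -scalerDl -scalerBl.
      by congr (_ *: _ + _ *: _); field.
    * move=> k; rewrite exprZn Mk /exp_coeff /= !scalerDr !scalerA.
      by congr (_ *: _ + _ *: _); rewrite exprMn; ring.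
    * exact: is_cvg_series_exp_coeff.
    * exact: is_cvg_series_exp_coeff.
-
  (* M / w is a square root of - 1. *)
  pose w := Num.sqrt (\det M).
  have w0 : w != 0 by rewrite gt_eqF // sqrtr_gt0.
  have w2 : w ^+ 2 = \det M by rewrite sqr_sqrtr // ltW.
  have Me k : M ^+ k.*2 = ((-1) ^+ k * w ^+ k.*2) *: 1%:M.
    elim: k => [|k IH]; first by rewrite !expr0 mulr1 scale1r.
    rewrite doubleS !exprS mulrA IH -[M * M]/(M *m M) MM -w2.
    rewrite -[_ *: _ * _]/(_ *: _ *m _) -scalemxAl mul1mx scalerA; congr (_ *: _).
    by rewrite expr2; ring.
  exists (fun t => cos (w * t)), (fun t => sin (w * t) * w^-1); split.
  + by rewrite mulr0 cos0 sin0 mul0r.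
  + apply: (is_derive_eq (is_derive_chain (id1 w) (is_derive_cos _))).
    by rewrite mulr0 sin0 oppr0 mul0r.
  + apply: (is_derive_eq (is_derive_mul (is_derive_chain (id1 w) (is_derive_sin _)) (K _))).
    by rewrite mulr0 cos0 mul1r mulr0 addr0 mulfV.
  + move=> t; rewrite -w2 -(cos2Dsin2 (w * t)); by field.
  + move=> t; rewrite -scalerA.
    apply: (@expmx_comb _ _ _ (cos_coeff (w * t)) (sin_coeff (w * t))).
    * move=> k; rewrite exprZn -[k]odd_double_half; case: (odd k) => /=.
        rewrite add1n /cos_coeff /sin_coeff /= odd_double /= doubleK.
        rewrite !mul0r scale0r add0r exprS [M ^+ _.+1]exprS Me.
        rewrite -[M * _]/(M *m _) -scalemxAr mulmx1 !scalerA; congr (_ *: _).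
        by rewrite !exprS !exprMn; field; rewrite w0 pnatr_eq0 -lt0n fact_gt0.
      rewrite add0n /cos_coeff /sin_coeff /= odd_double /= doubleK.
      rewrite !mul0r scale0r addr0 Me !scalerA; congr (_ *: _).
      by rewrite -exprnP exprMn mul1r; ring.
    * rewrite unlock; exact: is_cvg_series_cos_coeff.
    * rewrite unlock; exact: is_cvg_series_sin_coeff.
-
  (* M is nilpotent. *)
  have M2 : M *m M = 0 by rewrite MM d0 oppr0 scale0r.
  exists (fun=> 1), id; split=> //.
  + exact: is_derive_id.
  + by move=> t; rewrite d0 mul0r addr0 expr1n.
  + move=> t; rewrite -[t *: M in RHS]scale1r.
    apply: (@expmx_comb _ _ _ (fun k => (k == 0%N)%:R) (fun k => (k == 1%N)%:R)).
    * case=> [|[|k]] /=.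
      - by rewrite expr0 fact0 invr1 scale0r addr0.
      - by rewrite expr1 factS fact0 muln1 invr1 scale0r add0r.
      - have Mk : M ^+ k.+2 = 0 by rewrite 2!exprS mulrA -[M * M]/(M *m M) M2 mul0r.
        by rewrite !scale0r addr0 exprZn Mk !scaler0.
    * apply: cvg_near_cst; exists 1%N => // -[|n] // _.
      rewrite /series /= big_nat_recl //= big1 ?addr0 // => k _.
    * apply: cvg_near_cst; exists 2%N => // -[|[|n]] // _.
      rewrite /series /= big_nat_recl //= big_nat_recl //= big1 ?addr0 ?add0r // => k _.
Qed.

Lemma expmx_SL2 (xi : sl2 R) : exists c s : R -> R,
  [/\ c 0 = 1 /\ s 0 = 0, is_derive (0 : R) 1 c 0, is_derive (0 : R) 1 s 1 &
      forall t, SL2_val (insubd (SL2_1 R) (expmx (sl2_val (t *: xi)))) =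
                c t *: 1%:M + s t *: sl2_val xi].
Proof.
have tr0 : \tr (sl2_val xi) = 0 by apply/eqP; exact: (valP xi).
have [c [s [cs0 dc ds cs eE]]] := expmx_traceless tr0.
exists c, s; split=> // t.
have E : expmx (sl2_val (t *: xi)) = c t *: 1%:M + s t *: sl2_val xi by rewrite -eE.
rewrite -[SL2_val _]/(val _) insubdK // E /in_mem /= det_mx2 !mxE /=.
have := cs t; rewrite det_mx2.
move: tr0; rewrite mxtrace2 => /eqP; rewrite addrC addr_eq0 => /eqP -> ct.
by apply/eqP; rewrite ?mulr1n ?mulr0n -[RHS]ct; ring.
Qed.

End Exponential.

(** * The moment map of PSL(2, R) *)

Section PSL2Moment.
Variables (R : realType) (f : R -> R).
Hypothesis f_smooth : smooth_half_line f.
Implicit Types (q d : coords R) (xi : sl2 R).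

(** For xi with rows (a, b) and (c, - a), this is the velocity of the orbit,
    dz/dt = b + 2 a z - c z^2 and dkappa/dt = 4 kappa (c conj z - a). *)
Definition sl2_field xi q : coords R :=
  let a := sl2_val xi 0 0 in let b := sl2_val xi 0 1 in let c := sl2_val xi 1 0 in
  Coords (b + 2 * a * cx q - c * (cx q ^+ 2 - cy q ^+ 2))
         (2 * a * cy q - 2 * c * cx q * cy q)
         (4 * (c * (cx q * cu q + cy q * cv q) - a * cu q))
         (4 * (c * (cx q * cv q - cy q * cu q) - a * cv q)).

(** The coordinates of A_t p are read off from four components of A_t p, which
    are polynomials in the entries of A_t. *)
Lemma is_derive_SL2_orbit (A : R -> SL2 R) q xi : cy q != 0 ->
  SL2_val (A 0) = 1%:M ->
  (forall i j, is_derive (0 : R) 1 (fun t => SL2_val (A t) i j) (sl2_val xi i j)) ->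
  is_derive_coords (fun t => chart_inv (SL2_act (A t) (chart q))) 0 (sl2_field xi q).
Proof.
move=> y0 A0 dA.
have x11 : sl2_val xi 1 1 = - sl2_val xi 0 0.
  have /eqP := valP xi; rewrite mxtrace2 addrC => /eqP; rewrite addr_eq0 => /eqP.
  exact.
pose a t := SL2_val (A t) 0 0; pose b t := SL2_val (A t) 0 1.
pose c t := SL2_val (A t) 1 0; pose e t := SL2_val (A t) 1 1.
have [a0 b0 c0 e0] : [/\ a 0 = 1, b 0 = 0, c 0 = 0 & e 0 = 1].
  by rewrite /a /b /c /e A0 !mxE.
have da : is_derive (0 : R) 1 a (sl2_val xi 0 0) := dA 0 0.
have db : is_derive (0 : R) 1 b (sl2_val xi 0 1) := dA 0 1.
have dc : is_derive (0 : R) 1 c (sl2_val xi 1 0) := dA 1 0.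
have de : is_derive (0 : R) 1 e (- sl2_val xi 0 0) by rewrite -x11; exact: dA 1 1.
pose J := cplx_structure q; pose P n := (quartic_coef q n).1.
have J0 t i : (SL2_act (A t) (chart q)).1 i 0 =
    (SL2_val (A t) i 0 * J 0 0 + SL2_val (A t) i 1 * J 1 0) * e t
    - (SL2_val (A t) i 0 * J 0 1 + SL2_val (A t) i 1 * J 1 1) * c t.
  by rewrite /= mulmx3E SL2_inv !mxE /= mulrN.
have T0 t : (SL2_act (A t) (chart q)).2 (mxvec_index 0 0) (mxvec_index 0 0) =
    P 0%N * (e t * e t * e t * e t) - 4 * P 1%N * (e t * e t * e t * c t)
    + 6 * P 2%N * (e t * e t * c t * c t)
    - 4 * P 3%N * (e t * c t * c t * c t) + P 4%N * (c t * c t * c t * c t).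
  rewrite SL2_act_symmetric SL2_inv teval_symmetric_tensor !mxE.
  by rewrite /P /c /e /=; ring.
have T1 t : (SL2_act (A t) (chart q)).2 (mxvec_index 0 0) (mxvec_index 0 1) =
    - P 0%N * (e t * e t * e t * b t)
    + P 1%N * (e t * e t * e t * a t + 3 * (e t * e t * c t * b t))
    - P 2%N * (3 * (e t * e t * c t * a t) + 3 * (e t * c t * c t * b t))
    + P 3%N * (3 * (e t * c t * c t * a t) + c t * c t * c t * b t)
    - P 4%N * (c t * c t * c t * a t).
  rewrite SL2_act_symmetric SL2_inv teval_symmetric_tensor !mxE.
  by rewrite /P /a /b /c /e /=; ring.
pose j0 t := (a t * J 0 0 + b t * J 1 0) * e t - (a t * J 0 1 + b t * J 1 1) * c t.
pose j1 t := (c t * J 0 0 + e t * J 1 0) * e t - (c t * J 0 1 + e t * J 1 1) * c t.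
have j00 : j0 0 = J 0 0 by rewrite /j0 a0 b0 c0 e0; ring.
have j10 : j1 0 = J 1 0 by rewrite /j1 c0 e0; ring.
have JE : [/\ J 0 0 = cx q / cy q, J 0 1 = - ((cx q ^+ 2 + cy q ^+ 2) / cy q),
    J 1 0 = (cy q)^-1 & J 1 1 = - (cx q / cy q)] by rewrite /J !mxE.
have [E00 E01 E10 E11] := JE.
have dj0 : is_derive (0 : R) 1 j0 (sl2_val xi 0 1 * (J 1 0) - sl2_val xi 1 0 * J 0 1).
  by apply: is_derive_eq; rewrite /GRing.scale /= a0 b0 c0 e0; ring.
have dj1 : is_derive (0 : R) 1 j1
    (2 * (sl2_val xi 1 0 * J 0 0 - sl2_val xi 0 0 * J 1 0)).
  by apply: is_derive_eq; rewrite /GRing.scale /= c0 e0 E00 E10 E11; ring.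
pose t0 t := P 0%N * (e t * e t * e t * e t) - 4 * P 1%N * (e t * e t * e t * c t)
    + 6 * P 2%N * (e t * e t * c t * c t)
    - 4 * P 3%N * (e t * c t * c t * c t) + P 4%N * (c t * c t * c t * c t).
pose t1 t := - P 0%N * (e t * e t * e t * b t)
    + P 1%N * (e t * e t * e t * a t + 3 * (e t * e t * c t * b t))
    - P 2%N * (3 * (e t * e t * c t * a t) + 3 * (e t * c t * c t * b t))
    + P 3%N * (3 * (e t * c t * c t * a t) + c t * c t * c t * b t)
    - P 4%N * (c t * c t * c t * a t).
have dt0 : is_derive (0 : R) 1 t0 (- 4 * sl2_val xi 0 0 * P 0%N - 4 * sl2_val xi 1 0 * P 1%N).
  by apply: is_derive_eq; rewrite /GRing.scale /= c0 e0; ring.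
have dt1 : is_derive (0 : R) 1 t1
    (- sl2_val xi 0 1 * P 0%N - 2 * sl2_val xi 0 0 * P 1%N - 3 * sl2_val xi 1 0 * P 2%N).
  by apply: is_derive_eq; rewrite /GRing.scale /= a0 b0 c0 e0; ring.
have t00 : t0 0 = P 0%N by rewrite /t0 c0 e0; ring.
have t10 : t1 0 = P 1%N by rewrite /t1 a0 b0 c0 e0; ring.
have jn : j1 0 != 0 by rewrite j10 E10 invr_eq0.
have IE t : chart_inv (SL2_act (A t) (chart q)) =
    Coords (j0 t * (j1 t)^-1) (j1 t)^-1 (t0 t) (- (j1 t * t1 t + j0 t * t0 t)).
  by rewrite /chart_inv !J0 T0 T1.
have P1 : P 1%N = - cx q * cu q - cy q * cv q by [].
have P2 : P 2%N = - cx q * (- cx q * cu q - cy q * cv q) - cy q * (cy q * cu q - cx q * cv q) by [].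
have P0 : P 0%N = cu q by [].
have dV := is_derive_inv dj1 jn.
split; under eq_fun do rewrite IE /=.
- apply: (is_derive_eq (is_derive_mul dj0 dV)).
  by rewrite j00 j10 E00 E01 E10 /=; field.
- by apply: (is_derive_eq dV); rewrite j10 E00 E10 /=; field.
- by apply: (is_derive_eq dt0); rewrite P0 P1 /=; ring.
- apply: (is_derive_eq (is_derive_opp (is_derive_add (is_derive_mul dj1 dt1) (is_derive_mul dj0 dt0)))).
  by rewrite j00 j10 t00 t10 P0 P1 P2 E00 E01 E10 /=; field.
Qed.

Lemma is_derive_orbit q xi : chart_dom q ->
  is_derive (0 : R) 1 (action_orbit (@PSL2_act R) xi (chart q))
    (d_chart q (sl2_field xi q)).
Proof.
move=> dq; have [y0 _] := dq; have yn : cy q != 0 by rewrite gt_eqF.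
have [c [s [[c0 s0] dc ds eE]]] := expmx_SL2 xi.
pose A t := insubd (SL2_1 R) (expmx (sl2_val (t *: xi))).
have oE : action_orbit (@PSL2_act R) xi (chart q) =
    fun t => chart (chart_inv (SL2_act (A t) (chart q))).
  apply/funext => t; rewrite /action_orbit -[lie_exp _]/(PSL2_exp _) /PSL2_exp.
  rewrite PSL2_act_pi -/(A t).
  by have [_ ->] := MF_chart (SL2_act_MF (A t) (chart_MF dq)).
have A0 : SL2_val (A 0) = 1%:M by rewrite eE c0 s0 scale0r addr0 scale1r.
have dA i j : is_derive (0 : R) 1 (fun t => SL2_val (A t) i j) (sl2_val xi i j).
  under eq_fun do rewrite eE !mxE.
  have K (w : R) := is_derive_const w (0 : R).
  apply: (is_derive_eq (is_derive_add (is_derive_mul dc (K _)) (is_derive_mul ds (K _)))).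
  by rewrite !(mul0r, mulr0, addr0, add0r) mul1r.
rewrite oE; clearbody A; clear oE eE.
have q0 : chart_inv (SL2_act (A 0) (chart q)) = q.
  have -> : A 0 = SL2_1 R by exact: val_inj.
  by rewrite SL2_act1 chartK.
pose c' t := chart_inv (SL2_act (A t) (chart q)).
have dc' : is_derive_coords c' 0 (sl2_field xi q) by exact: is_derive_SL2_orbit yn A0 dA.
have yc : cy (c' 0) != 0 by rewrite /c' q0.
have H := is_derive_chart yc dc'.
by have e : c' 0 = q := q0; rewrite e in H.
Qed.

Lemma derive_PSL2_moment q d xi : chart_dom q ->
  'D_(d_chart q d) (fun p => PSL2_moment f p xi : R) (chart q) =
  - (half_line_derive f (norm2 q) * d_norm2 q d) * \tr (sl2_val xi *m cplx_structure q)
  + (1 - f (norm2 q)) * \tr (sl2_val xi *m d_cplx_structure q d).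
Proof.
move=> dq; have [y0 _] := dq; have yn : cy q != 0 by rewrite gt_eqF.
have oO := @open_coord_dom R.
pose g (p : ambient R) := \tr (sl2_val xi *m p.1).
pose h q := \tr (sl2_val xi *m cplx_structure q).
have cg : Ck 1 (@coord_dom R) g.
  apply: (Ck_ext oO (F := fun p : ambient R => sl2_val xi 0 0 * p.1 0 0
    + sl2_val xi 0 1 * p.1 1 0 + (sl2_val xi 1 0 * p.1 0 1 + sl2_val xi 1 1 * p.1 1 1))).
    by move=> p _; rewrite /g mxtrace_mul2.
  by do 2 (apply: CkD => //); apply: Ck_scale => //; exact: Ck_ambientJ.
have K (w : R) := is_derive_const w (0 : R).
have y00 : cy (affine_coords q d 0) != 0 by rewrite affine_coords0.
have dJ i j := is_derive_cplx_structure i j y00 (is_derive_affine_coords q d 0).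
rewrite [LHS](derive_1f_mul f_smooth (g := g) (h := h)
  (l := \tr (sl2_val xi *m d_cplx_structure q d)) dq cg) //.
rewrite mxtrace_mul2.
have H := is_derive_add
  (is_derive_add (is_derive_mul (K (sl2_val xi 0 0)) (dJ 0 0))
                 (is_derive_mul (K (sl2_val xi 0 1)) (dJ 1 0)))
  (is_derive_add (is_derive_mul (K (sl2_val xi 1 0)) (dJ 0 1))
                 (is_derive_mul (K (sl2_val xi 1 1)) (dJ 1 1))).
apply: (near_eq_is_derive _ (is_derive_eq H _)).
  by near=> s; rewrite /h mxtrace_mul2.
by rewrite affine_coords0 !mul0r !add0r.
Unshelve. all: by end_near. Qed.

Lemma PSL2_moment_map : moment_map (@MF R) (omega_f f) (@PSL2_act R) (PSL2_moment f).
Proof.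
have oO := @open_coord_dom R.
split.
- move=> xi; exists (@coord_dom R); split=> //; first exact: MF_coord_dom.
  move=> k; apply: CkM => //; first exact: Ck_1f.
  apply: (Ck_ext oO (F := fun p : ambient R => sl2_val xi 0 0 * p.1 0 0
    + sl2_val xi 0 1 * p.1 1 0 + (sl2_val xi 1 0 * p.1 0 1 + sl2_val xi 1 1 * p.1 1 1))).
    by move=> p _; rewrite mxtrace_mul2.
  by do 2 (apply: CkD => //); apply: Ck_scale => //; exact: Ck_ambientJ.
- by move=> g p xi Mp; exact: PSL2_moment_equivariant.
move=> xi p Mp; have [dq <-] := MF_chart Mp; move: (chart_inv p) dq => q dq.
have [y0 k0] := dq; have yn : cy q != 0 by rewrite gt_eqF.
have [dO1 dO2] := is_derive_orbit xi dq.
split=> // v /(tangent_chart dq)[d ->].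
rewrite /fundamental_field derive1E dO2 omega_chart // derive_PSL2_moment //.
rewrite !mxtrace_mul2 !mxE /hor_re /hor_im /d_norm2 /=.
have x11 : sl2_val xi 1 1 = - sl2_val xi 0 0.
  have /eqP := valP xi; rewrite mxtrace2 addrC => /eqP; rewrite addr_eq0 => /eqP.
  exact.
rewrite x11; move: (f _) (half_line_derive _ _) => F F'; by field.
Qed.

End PSL2Moment.

Theorem theoremC (R : realType) (f : R -> R)
    (f_smooth : smooth_half_line f)
    (f_0 : f 0 = 0)
    (f_le0 : forall t : R, 0 <= t -> f t <= 0)
    (f'_lt0 : forall t : R, 0 <= t -> half_line_derive f t < 0) :
  [/\ hamiltonian_action (@MF R) (omega_f f) (@S1_act R),
      hamiltonian_action (@MF R) (omega_f f) (@PSL2_act R) &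
      exists (mu1 : ambient R -> {scalar (lie_algebra (S1 R))})
             (mu2 : ambient R -> {scalar (lie_algebra (PSL2R R))})
             (xi : lie_algebra (PSL2R R))
             (th1 : ambient R -> circle R) (H1 th2 H2 : ambient R -> R),
        [/\ moment_map (@MF R) (omega_f f) (@S1_act R) mu1,
            moment_map (@MF R) (omega_f f) (@PSL2_act R) mu2,
            xi != 0,
            (forall p, MF p -> H1 p = mu1 p (1 : R^o) /\ H2 p = mu2 p xi) &
            darboux_frame (@MF R) (omega_f f) th1 H1 th2 H2]].
Proof.
have S1m := S1_moment_map f_smooth; have PSL2m := PSL2_moment_map f_smooth.
split.
- by split; [exact: S1_symplectic|exists (S1_moment f)].
- by split; [exact: PSL2_symplectic|exists (PSL2_moment f)].
have tr0 : (delta_mx 0 1 : 'M[R]_2) \in @traceless R.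
  by rewrite /in_mem /= /traceless mxtrace2 !mxE /= addr0.
(* E_01 generates the translations z |-> z + t, and tr (E_01 J) = J_10 = 1 / y. *)
exists (S1_moment f), (PSL2_moment f), (MkSl2 tr0), (@minus_arg R), (action1 f).
exists (fun p => cx (chart_inv p)), (action2 f); split=> //.
- apply/eqP => /(congr1 (fun x => sl2_val x 0 1)); rewrite !mxE /=.
  by move/eqP; rewrite oner_eq0.
- move=> p _; split; first by rewrite /= mul1r.
  by rewrite /= mxtrace_mul2 !mxE /= !mul0r mul1r !addr0 add0r.
split.
- exists (action_range f); split; first exact: open_action_range.
  exact: darboux_diffeomorphism.
- by move=> p v w Mp Tv Tw; exact: darboux_form.
Qed.
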